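(* For all $k \in \mathbb{N} \cup \{\aleph_0\}$ there exists a $3$-dimensional elliptic manifold $S$ with $\pi_1(S) \cong F_k$ and $\pi_n(S) = 0$ for all $n > 1$.
   Context: $F_k$ denotes the free group of rank $k$; $\mathbb{N}$ includes $0$, with $F_0$ the trivial group. Dimension means complex dimension, and manifolds whose homotopy groups are considered are understood to be connected. A complex manifold $M$ is elliptic if there exist a holomorphic vector bundle $E \to M$ and a holomorphic map $s : E \to M$ (called a dominating spray) such that, for all $x \in M$, $s(0_x) = x$ and the restriction $s|_{E_x} : E_x \to M$ to the fibre $E_x$ is a submersion at $0_x$, where $0_x$ is the zero vector of $E_x$. *)

(* Defs.v *)
From HB Require Import structures.
From mathcomp Require Import all_boot all_order all_algebra ring lra.
From mathcomp Require Import complex.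
From mathcomp Require Import boolp classical_sets functions cardinality.
From mathcomp Require Import interval_inference reals topology normedtype derive.

Set Implicit Arguments.
Unset Strict Implicit.
Unset Printing Implicit Defensive.

Import Order.TTheory GRing.Theory Num.Theory.
Import numFieldNormedType.Exports.

Local Open Scope classical_set_scope.
Local Open Scope ring_scope.
Local Open Scope quotient_scope.
Local Open Scope complex_scope.

Section ComplexManifolds.
Variable R : realType.
Local Notation C := R[i].

(* Only the values of [chart_map] on [chart_dom], and those of [chart_inv] on *)
(* the image of [chart_dom], are meaningful. *)
Record chart (T : topologicalType) (V : normedModType C) := Chart {
  chart_dom : set T;
  chart_map :> T -> V;
  chart_inv : V -> T }.

Definition chart_image T V (c : chart T V) : set V := c @` chart_dom c.

(* [c] is a homeomorphism from an open subset of [T] onto an open subset *)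
(* of [V]. *)
Definition is_chart T V (c : chart T V) : Prop :=
  [/\ open (chart_dom c), open (chart_image c),
      {in chart_dom c, cancel c (chart_inv c)},
      {within chart_dom c, continuous c}
    & {within chart_image c, continuous (chart_inv c)}].

Record charted_space (V : normedModType C) := ChartedSpace {
  charted_top :> topologicalType;
  atlas : set (chart charted_top V) }.
Arguments atlas {V} c.

(* The transition map is complex differentiable at each point of an open set, *)
(* that is, holomorphic there. *)
Definition holomorphic_transition T V (c d : chart T V) : Prop :=
  forall x, chart_dom c x -> chart_dom d x ->
    differentiable (d \o chart_inv c) (c x).

Record complex_manifold (V : normedModType C) := ComplexManifold {
  charted_of :> charted_space V;
  manifold_hausdorff : hausdorff_space charted_of;
  manifold_second_countable : @second_countable charted_of;
  manifold_charts : forall c, atlas charted_of c -> is_chart c;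
  manifold_cover : forall x : charted_of,
    exists2 c, atlas charted_of c & chart_dom c x;
  manifold_transitions : forall c d, atlas charted_of c -> atlas charted_of d ->
    holomorphic_transition c d }.

Definition vector_space (V : normedModType C) : charted_space V :=
  @ChartedSpace V V [set Chart setT idfun idfun].

Definition prod_chart T U (V W : normedModType C) (c : chart T V)
    (d : chart U W) : chart (T * U)%type (V * W)%type :=
  Chart (chart_dom c `*` chart_dom d) (fun p => (c p.1, d p.2))
    (fun q => (chart_inv c q.1, chart_inv d q.2)).

Definition prod_space (V W : normedModType C) (M : charted_space V)
    (N : charted_space W) : charted_space (V * W)%type :=
  @ChartedSpace (V * W)%type (M * N)%type
    [set e | exists2 c, atlas M c & exists2 d, atlas N d & e = prod_chart c d].

Section Maps.
Variables (V W : normedModType C) (M : charted_space V) (N : charted_space W).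
Implicit Types (f : M -> N) (A : set M).

Definition holomorphic_at f (x : M) : Prop :=
  {for x, continuous f} /\
  forall c d, atlas M c -> atlas N d -> chart_dom c x -> chart_dom d (f x) ->
    differentiable (d \o f \o chart_inv c) (c x).

Definition holomorphic_on f A : Prop := forall x, A x -> holomorphic_at f x.

Definition holomorphic f : Prop := forall x, holomorphic_at f x.

Definition submersion_at f (x : M) : Prop :=
  holomorphic_at f x /\
  forall c d, atlas M c -> atlas N d -> chart_dom c x -> chart_dom d (f x) ->
    forall w : W, exists v : V, 'd (d \o f \o chart_inv c) (c x) v = w.

End Maps.

Section VectorBundles.
Variables (V : normedModType C) (M : complex_manifold V).

(* [phi] is a biholomorphism from [proj @^-1` U] onto [U * C^r], with inverse *)
(* [psi], over [U] and linear on the fibres. *)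
Definition local_trivialization (r : nat)
    (E : charted_space (V * 'rV[C]_r)%type) (proj : E -> M)
    (fibre : M -> lmodType C) (incl : forall x, fibre x -> E) (U : set M)
    (phi : E -> prod_space M (vector_space 'rV[C]_r))
    (psi : prod_space M (vector_space 'rV[C]_r) -> E) : Prop :=
  [/\ open U,
      forall e, U (proj e) -> (phi e).1 = proj e /\ psi (phi e) = e,
      forall q, U q.1 -> proj (psi q) = q.1 /\ phi (psi q) = q,
      holomorphic_on phi (proj @^-1` U) /\
      holomorphic_on psi [set q | U q.1]
    & forall x, U x -> linear (fun v : fibre x => (phi (incl x v)).2)].

(* The rank is constant, which is no restriction over a connected base. *)
(* The fibre over [x] is the vector space [fibre x], identified by [incl x] *)
(* with the preimage of [x] in the total space. *)
Record vector_bundle (r : nat) := VectorBundle {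
  total_space : complex_manifold (V * 'rV[C]_r)%type;
  bundle_proj : total_space -> M;
  fibre : M -> lmodType C;
  fibre_incl : forall x, fibre x -> total_space;
  bundle_proj_holomorphic : holomorphic bundle_proj;
  fibre_incl_injective : forall x, injective (@fibre_incl x);
  fibre_incl_range : forall x,
    range (@fibre_incl x) = bundle_proj @^-1` [set x];
  bundle_trivial : forall x, exists U, U x /\
    exists phi psi, local_trivialization bundle_proj fibre_incl U phi psi }.

(* The restriction of [s] to the fibre over [x] is read in an arbitrary linear *)
(* coordinate system of the fibre. *)
Definition dominating_spray r (E : vector_bundle r) (s : total_space E -> M) :=
  holomorphic s /\
  forall x, s (fibre_incl (0 : fibre E x)) = x /\
    forall l : {linear 'rV[C]_r -> fibre E x}, bijective l ->
      submersion_at (M := vector_space 'rV[C]_r)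
        (fun v => s (fibre_incl (l v))) 0.

Definition elliptic : Prop :=
  exists r (E : vector_bundle r) (s : total_space E -> M), dominating_spray s.

End VectorBundles.
End ComplexManifolds.

Section FreeGroup.
Variable X : choiceType.

(* The letter [(a, true)] is the generator [a], and [(a, false)] its inverse. *)
Definition word := seq (X * bool).

Inductive word_eq : word -> word -> Prop :=
| word_eq_refl u : word_eq u u
| word_eq_sym u v : word_eq u v -> word_eq v u
| word_eq_trans u v w : word_eq u v -> word_eq v w -> word_eq u w
| word_eq_cancel u v a b : word_eq (u ++ [:: (a, b); (a, ~~ b)] ++ v) (u ++ v).

Definition word_eqb (u v : word) : bool := `[< word_eq u v >].

Lemma word_eqb_refl : reflexive word_eqb.
Proof. by move=> u; apply/asboolP; exact: word_eq_refl. Qed.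

Lemma word_eqb_sym : symmetric word_eqb.
Proof.
by move=> u v; apply/asboolP/asboolP => /word_eq_sym.
Qed.

Lemma word_eqb_trans : transitive word_eqb.
Proof.
move=> v u w /asboolP uv /asboolP vw; apply/asboolP.
exact: word_eq_trans uv vw.
Qed.

Canonical word_equiv :=
  EquivRel word_eqb word_eqb_refl word_eqb_sym word_eqb_trans.

Definition free_group := {eq_quot word_equiv}.
HB.instance Definition _ := Choice.on free_group.
HB.instance Definition _ := Quotient.on free_group.

Definition word_inv (u : word) : word := rev [seq (p.1, ~~ p.2) | p <- u].

Definition free_group_class (u : word) : free_group := \pi u.

Lemma free_group_classP u v : free_group_class u = free_group_class v <-> word_eq u v.
Proof. by split=> [/eqmodP/asboolP|uv]; last exact/eqmodP/asboolP. Qed.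

Lemma free_group_class_repr a : free_group_class (repr a) = a. Proof. exact: reprK. Qed.

Lemma word_eq_catl w u v : word_eq u v -> word_eq (w ++ u) (w ++ v).
Proof.
elim=> [u'|u' v' _|u' v' w' _ uv _|u' v' a b].
- exact: word_eq_refl.
- exact: word_eq_sym.
- exact: word_eq_trans.
- rewrite 2!(catA w); exact: word_eq_cancel.
Qed.

Lemma word_eq_catr w u v : word_eq u v -> word_eq (u ++ w) (v ++ w).
Proof.
elim=> [u'|u' v' _|u' v' w' _ uv _|u' v' a b].
- exact: word_eq_refl.
- exact: word_eq_sym.
- exact: word_eq_trans.
- by rewrite -!catA; exact: word_eq_cancel.
Qed.

Lemma word_eq_inv u v : word_eq u v -> word_eq (word_inv u) (word_inv v).
Proof.
elim=> [u'|u' v' _|u' v' w' _ uv _|u' v' a b].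
- exact: word_eq_refl.
- exact: word_eq_sym.
- exact: word_eq_trans.
- rewrite /word_inv !map_cat !rev_cat -!catA /= negbK.
  exact: word_eq_cancel.
Qed.

Lemma word_mulVw u : word_eq (word_inv u ++ u) [::].
Proof.
elim: u => [|[a b] u IH]; first exact: word_eq_refl.
rewrite /word_inv /= rev_cons cat_rcons.
apply: word_eq_trans IH.
by have := word_eq_cancel (word_inv u) u a (~~ b); rewrite negbK.
Qed.

Lemma word_invK u : word_inv (word_inv u) = u.
Proof.
rewrite /word_inv map_rev revK -map_comp -[RHS]map_id.
by apply: eq_map => -[a b] /=; rewrite negbK.
Qed.

Definition free_group_one : free_group := free_group_class [::].
Definition free_group_inv (a : free_group) : free_group :=
  free_group_class (word_inv (repr a)).
Definition free_group_mul (a b : free_group) : free_group :=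
  free_group_class (repr a ++ repr b).

Lemma free_group_mul_class u v :
  free_group_mul (free_group_class u) (free_group_class v) = free_group_class (u ++ v).
Proof.
apply/free_group_classP; apply: (word_eq_trans (v := u ++ repr (free_group_class v))).
  by apply: word_eq_catr; apply/free_group_classP; rewrite free_group_class_repr.
by apply: word_eq_catl; apply/free_group_classP; rewrite free_group_class_repr.
Qed.

Lemma free_group_inv_class u : free_group_inv (free_group_class u) = free_group_class (word_inv u).
Proof. by apply/free_group_classP/word_eq_inv; apply/free_group_classP; rewrite free_group_class_repr. Qed.

Lemma free_group_mulA : associative free_group_mul.
Proof.
move=> a b c; rewrite -(free_group_class_repr a) -(free_group_class_repr b).
rewrite -(free_group_class_repr c).
by rewrite !free_group_mul_class catA.
Qed.

Lemma free_group_mul1g : left_id free_group_one free_group_mul.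
Proof. by move=> a; rewrite -(free_group_class_repr a) free_group_mul_class. Qed.

Lemma free_group_mulg1 : right_id free_group_one free_group_mul.
Proof. by move=> a; rewrite -(free_group_class_repr a) free_group_mul_class cats0. Qed.

Lemma free_group_mulVg : left_inverse free_group_one free_group_inv free_group_mul.
Proof.
by move=> a; rewrite -(free_group_class_repr a) free_group_inv_class free_group_mul_class; apply/free_group_classP/word_mulVw.
Qed.

Lemma free_group_mulgV : right_inverse free_group_one free_group_inv free_group_mul.
Proof.
move=> a; rewrite -(free_group_class_repr a) free_group_inv_class free_group_mul_class; apply/free_group_classP.
by rewrite -{1}(word_invK (repr a)); exact: word_mulVw.
Qed.

HB.instance Definition _ :=
  isGroup.Build free_group
    free_group_mulA free_group_mul1g free_group_mulg1 free_group_mulVg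
    free_group_mulgV.

End FreeGroup.

Definition isomorphic_groups (G H : groupType) : Prop :=
  exists f : {multiplicative G -> H}, bijective f.

(* [None] stands for the rank aleph_0. *)
Definition free_group_of_rank (k : option nat) : groupType :=
  if k is Some n then free_group 'I_n else free_group nat.

Section Continuity.

Lemma continuous_within_comp (T U W : topologicalType) (A : set T) (B : set U)
    (f : T -> U) (g : U -> W) :
  continuous f -> (forall t, A t -> B (f t)) ->
  {within B, continuous g} -> {within A, continuous (g \o f)}.
Proof.
move=> cf AB /subspace_continuousP cg; apply/subspace_continuousP => t At.
apply: (cvg_trans _ (cg _ (AB _ At))) => N /= hN.
have := cf t _ hN; rewrite /within /= !nbhs_simpl /=.
apply: filterS => u h Au; exact: h (AB _ Au).
Qed.

Lemma continuous_within_if (R : realType) (T W : topologicalType) (A : set T)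
    (h : T -> R) (c : R) (f g : T -> W) :
  continuous h ->
  {within A `&` [set t | h t <= c], continuous f} ->
  {within A `&` [set t | c <= h t], continuous g} ->
  (forall t, A t -> h t = c -> f t = g t) ->
  {within A, continuous (fun t => if h t <= c then f t else g t)}.
Proof.
move=> ch /subspace_continuousP cf /subspace_continuousP cg fg.
apply/subspace_continuousP => t At N hN0.
have hN : nbhs (if h t <= c then f t else g t) N := hN0.
have hf : \forall u \near t, A u -> h u <= c -> N (f u).
  have [htc|htc] := leP (h t) c.
    have hN' : nbhs (f t) N by move: (hN); rewrite htc.
    have : \forall u \near t, (A u /\ h u <= c) -> N (f u)
      := cf t (conj At htc) _ hN'.
    by apply: filterS => u hu Au hc; exact: hu (conj Au hc).
  have : \forall u \near t, c < h u
    := ch t _ (open_nbhs_nbhs (conj (@open_gt R c) htc)).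
  by apply: filterS => u /= hu _; rewrite leNgt hu.
have hg : \forall u \near t, A u -> c <= h u -> N (g u).
  have [htc|htc] := leP c (h t).
    have hN' : nbhs (g t) N.
      move: hN; case: ifPn => // htc'.
      by rewrite fg //; apply/eqP; rewrite eq_le htc htc'.
    have : \forall u \near t, (A u /\ c <= h u) -> N (g u)
      := cg t (conj At htc) _ hN'.
    by apply: filterS => u hu Au hc; exact: hu (conj Au hc).
  have : \forall u \near t, h u < c
    := ch t _ (open_nbhs_nbhs (conj (@open_lt R c) htc)).
  by apply: filterS => u /= hu _; rewrite leNgt hu.
apply: filterS2 hf hg => u h1 h2 Au; change (N (if h u <= c then f u else g u)).
case: ifPn => [|]; first exact: h1.
by rewrite -ltNge => /ltW; exact: h2.
Qed.

Lemma continuous_addf (R : realType) (T : topologicalType) (a b : T -> R) :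
  continuous a -> continuous b -> continuous (fun p => a p + b p).
Proof. by move=> ca cb p; apply: cvgD; [exact: ca|exact: cb]. Qed.

Lemma continuous_subf (R : realType) (T : topologicalType) (a b : T -> R) :
  continuous a -> continuous b -> continuous (fun p => a p - b p).
Proof. by move=> ca cb p; apply: cvgB; [exact: ca|exact: cb]. Qed.

Lemma continuous_mulf (R : realType) (T : topologicalType) (a b : T -> R) :
  continuous a -> continuous b -> continuous (fun p => a p * b p).
Proof. by move=> ca cb p; apply: cvgM; [exact: ca|exact: cb]. Qed.

Lemma continuous_cstf (R : realType) (T : topologicalType) (c : R) :
  continuous (fun _ : T => c).
Proof. by move=> p; exact: cvg_cst. Qed.

Lemma continuous_idf (T : topologicalType) : continuous (@idfun T).
Proof. by move=> p; exact: cvg_id. Qed.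

Lemma continuous_pair (T U W : topologicalType) (f : T -> U) (g : T -> W) :
  continuous f -> continuous g -> continuous (fun p => (f p, g p)).
Proof.
move=> cf cg p.
exact: (@cvg_pair _ _ _ (nbhs p) (nbhs (f p)) (nbhs (g p)) _ _ _ f g (cf p) (cg p)).
Qed.

End Continuity.

Section HomotopyGroups.
Variables (R : realType) (X : topologicalType) (x : X).

Definition cube n : set 'rV[R]_n := [set t | forall i, 0 <= t 0 i <= 1].

Definition cube_boundary n : set 'rV[R]_n :=
  [set t | cube t /\ exists i, t 0 i = 0 \/ t 0 i = 1].

(* Maps of pairs from the cube and its boundary to [(X, x)]. The values outside *)
(* the cube are arbitrary; [homotopic] ignores them. *)
Record spheroid n := Spheroid {
  spheroid_fun :> 'rV[R]_n -> X;
  spheroid_continuous : {within @cube n, continuous spheroid_fun};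
  spheroid_boundary : forall t, cube_boundary t -> spheroid_fun t = x }.

Arguments spheroid_continuous {n} s.

HB.instance Definition _ n := gen_eqMixin (spheroid n).
HB.instance Definition _ n := gen_choiceMixin (spheroid n).

Definition homotopic n (f g : spheroid n) : Prop :=
  exists H : 'rV[R]_n * R -> X,
    [/\ {within @cube n `*` [set s | 0 <= s <= 1], continuous H},
        forall t, cube t -> H (t, 0) = f t,
        forall t, cube t -> H (t, 1) = g t
      & forall t s, cube_boundary t -> 0 <= s <= 1 -> H (t, s) = x].

Lemma homotopic_refl n (f : spheroid n) : homotopic f f.
Proof.
exists (fun p => f p.1); split => // [|t s bt _]; last exact: spheroid_boundary.
apply: (continuous_within_comp (B := @cube n) (f := fst)) => [p|[t s] []//|].
  exact: cvg_fst.
exact: spheroid_continuous.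
Qed.

Lemma homotopic_sym n (f g : spheroid n) : homotopic f g -> homotopic g f.
Proof.
move=> [H [cH H0 H1 Hb]]; exists (fun p => H (p.1, 1 - p.2)); split.
- apply: (continuous_within_comp (f := fun p : 'rV[R]_n * R => (p.1, 1 - p.2)) _ _ cH).
    apply: continuous_pair => p; first exact: cvg_fst.
    by apply: cvgB; [exact: cvg_cst|exact: cvg_snd].
  by move=> [t s] [/= ct /andP[s0 s1]]; split => //=; lra.
- by move=> t ct /=; rewrite subr0 H1.
- by move=> t ct /=; rewrite subrr H0.
- by move=> t s bt s01; apply: Hb => //=; lra.
Qed.

Lemma homotopic_trans n (f g h : spheroid n) :
  homotopic f g -> homotopic g h -> homotopic f h.
Proof.
move=> [H [cH H0 H1 Hb]] [K [cK K0 K1 Kb]].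
exists (fun p => if p.2 <= 2^-1 then H (p.1, 2 * p.2) else K (p.1, 2 * p.2 - 1)).
split.
- apply: (@continuous_within_if R _ _ _ snd); first by move=> p; exact: cvg_snd.
  + apply: (continuous_within_comp (f := fun p : 'rV[R]_n * R => (p.1, 2 * p.2)) _ _ cH).
      apply: continuous_pair => p; first exact: cvg_fst.
      by apply: cvgM; [exact: cvg_cst|exact: cvg_snd].
    by move=> [t s] [] [/= ct /andP[s0 s1]] s2; split => //=; lra.
  + apply: (continuous_within_comp (f := fun p : 'rV[R]_n * R => (p.1, 2 * p.2 - 1)) _ _ cK).
      apply: continuous_pair => p; first exact: cvg_fst.
      apply: cvgB; last exact: cvg_cst.
      by apply: cvgM; [exact: cvg_cst|exact: cvg_snd].
    by move=> [t s] [] [/= ct /andP[s0 s1]] s2; split => //=; lra.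
  + move=> [t s] [/= ct _] ->; rewrite mulfV ?pnatr_eq0//.
    by rewrite subrr H1 // K0.
- by move=> t ct /=; rewrite invr_ge0 ler0n mulr0 H0.
- move=> t ct /=; rewrite ifF;
      last by apply/negbTE; rewrite -ltNge; lra.
  by rewrite (_ : 2 * 1 - 1 = 1) ?K1 //; ring.
- move=> t s bt /andP[s0 s1] /=; case: ifPn => [hs|]; first by apply: Hb => //; lra.
  by rewrite -ltNge => hs; apply: Kb => //; lra.
Qed.

Definition homotopicb n (f g : spheroid n) : bool := `[< homotopic f g >].

Lemma homotopicb_refl n : reflexive (@homotopicb n).
Proof. by move=> f; apply/asboolP; exact: homotopic_refl. Qed.

Lemma homotopicb_sym n : symmetric (@homotopicb n).
Proof. by move=> f g; apply/asboolP/asboolP => /homotopic_sym. Qed.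

Lemma homotopicb_trans n : transitive (@homotopicb n).
Proof.
move=> g f h /asboolP fg /asboolP gh; apply/asboolP.
exact: homotopic_trans fg gh.
Qed.

Canonical homotopic_equiv n := EquivRel (@homotopicb n)
  (@homotopicb_refl n) (@homotopicb_sym n) (@homotopicb_trans n).

Definition homotopy_group n := {eq_quot homotopic_equiv n}.
HB.instance Definition _ n := Choice.on (homotopy_group n).
HB.instance Definition _ n := Quotient.on (homotopy_group n).

Definition homotopy_class n (f : spheroid n) : homotopy_group n := \pi f.

Lemma homotopy_classP n (f g : spheroid n) :
  homotopy_class f = homotopy_class g <-> homotopic f g.
Proof. by split=> [/eqmodP/asboolP|fg]; last exact/eqmodP/asboolP. Qed.

Lemma homotopy_class_repr n (a : homotopy_group n) : homotopy_class (repr a) = a.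
Proof. exact: reprK. Qed.

Lemma constant_spheroid_continuous n :
  {within @cube n, continuous (fun=> x)}.
Proof. by apply: continuous_subspaceT => t; exact: cst_continuous. Qed.

Definition constant_spheroid n : spheroid n :=
  Spheroid (@constant_spheroid_continuous n) (fun _ _ => erefl).

Section Concatenation.
Variable n : nat.
Implicit Types (t : 'rV[R]_n.+1) (f g h : spheroid n.+1).

Definition set_coord0 t (a : R) : 'rV[R]_n.+1 :=
  \row_j (if j == 0 then a else t 0 j).

Lemma coord0_continuous (T : topologicalType) (u : T -> 'rV[R]_n.+1) :
  continuous u -> continuous (fun p => u p 0 0).
Proof.
move=> cu p.
apply: (@continuous_comp _ _ _ u (fun t => t 0 0) p (cu p)).
exact: coord_continuous.
Qed.

Lemma set_coord0_continuous (T : topologicalType) (u : T -> 'rV[R]_n.+1)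
    (a : T -> R) :
  continuous u -> continuous a -> continuous (fun p => set_coord0 (u p) (a p)).
Proof.
move=> cu ca.
have -> : (fun p => set_coord0 (u p) (a p)) =
    (fun p => u p + (a p - u p 0 0) *: (delta_mx 0 0 : 'rV[R]_n.+1)).
  apply/funext => p; apply/rowP => j; rewrite !mxE /=.
  by case: eqP => [->|_] /=; rewrite ?mulr1 ?mulr0 ?addr0 //; ring.
move=> p; apply: cvgD; first exact: cu.
apply: cvgZr_tmp; apply: cvgB; first exact: ca.
exact: coord0_continuous.
Qed.

Lemma set_coord0E t a : set_coord0 t a 0 0 = a.
Proof. by rewrite mxE eqxx. Qed.

Lemma set_coord0_idem t a b : set_coord0 (set_coord0 t a) b = set_coord0 t b.
Proof. by apply/rowP => j; rewrite !mxE; case: eqP. Qed.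

Lemma set_coord0_id t : set_coord0 t (t 0 0) = t.
Proof. by apply/rowP => j; rewrite mxE; case: eqP => // ->. Qed.

Lemma cube_set_coord0 t a : cube t -> 0 <= a <= 1 -> cube (set_coord0 t a).
Proof. by move=> ct a01 j; rewrite mxE; case: eqP. Qed.

Lemma boundary_set_coord0 t a :
  cube t -> a = 0 \/ a = 1 -> cube_boundary (set_coord0 t a).
Proof.
move=> ct a01; split; last by exists 0; rewrite set_coord0E.
by apply: cube_set_coord0 => //; case: a01 => ->; rewrite lexx ler01.
Qed.

Lemma boundary_set_coord0_or t (a : R) :
  cube_boundary t -> 0 <= a <= 1 ->
  (t 0 0 = 0 -> a = 0 \/ a = 1) -> (t 0 0 = 1 -> a = 0 \/ a = 1) ->
  cube_boundary (set_coord0 t a).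
Proof.
move=> [ct [i ti]] a01 a0 a1.
have [i0|/eqP i0] := eqVneq i 0.
  by apply: boundary_set_coord0 => //; move: ti; rewrite i0 => -[/a0|/a1].
split; first exact: cube_set_coord0.
by exists i; rewrite mxE; case: eqP i0.
Qed.

Definition concat_fun (f g : 'rV[R]_n.+1 -> X) t : X :=
  if t 0 0 <= 2^-1 then f (set_coord0 t (2 * t 0 0))
  else g (set_coord0 t (2 * t 0 0 - 1)).

Lemma concat_fun_boundary f g t : cube_boundary t -> concat_fun f g t = x.
Proof.
move=> bt; have /andP[t0 t1] := bt.1 0; rewrite /concat_fun.
case: ifPn => [h|]; last rewrite -ltNge => h.
  by apply/spheroid_boundary/boundary_set_coord0_or => //; lra.
by apply/spheroid_boundary/boundary_set_coord0_or => //; lra.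
Qed.

Lemma concat_fun_continuous f g :
  {within @cube n.+1, continuous (concat_fun f g)}.
Proof.
have cid := @continuous_idf 'rV[R]_n.+1.
apply: (@continuous_within_if R _ _ _ (fun t => t 0 0)).
- exact: coord0_continuous cid.
- apply: (@continuous_within_comp _ _ _ _ _
    (fun t : 'rV[R]_n.+1 => set_coord0 t (2 * t 0 0)) f _ _ (spheroid_continuous f)).
    apply: set_coord0_continuous => //.
    exact: continuous_mulf (@continuous_cstf _ _ 2) (coord0_continuous cid).
  move=> t [ct /= h]; have /andP[t0 t1] := ct 0.
  by apply: cube_set_coord0 => //; lra.
- apply: (@continuous_within_comp _ _ _ _ _
    (fun t : 'rV[R]_n.+1 => set_coord0 t (2 * t 0 0 - 1)) g _ _ (spheroid_continuous g)).
    apply: set_coord0_continuous => //.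
    apply: continuous_subf; last exact: continuous_cstf.
    exact: continuous_mulf (@continuous_cstf _ _ 2) (coord0_continuous cid).
  move=> t [ct /= h]; have /andP[t0 t1] := ct 0.
  by apply: cube_set_coord0 => //; lra.
- move=> t ct t2; rewrite !spheroid_boundary //; apply: boundary_set_coord0 => //.
    by left; lra.
  by right; lra.
Qed.

Definition concat f g : spheroid n.+1 :=
  Spheroid (@concat_fun_continuous f g) (@concat_fun_boundary f g).

Definition reverse_fun (f : 'rV[R]_n.+1 -> X) t : X :=
  f (set_coord0 t (1 - t 0 0)).

Lemma reverse_fun_boundary f t : cube_boundary t -> reverse_fun f t = x.
Proof.
move=> bt; have /andP[t0 t1] := bt.1 0.
by apply/spheroid_boundary/boundary_set_coord0_or => //; lra.
Qed.

Lemma reverse_fun_continuous f :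
  {within @cube n.+1, continuous (reverse_fun f)}.
Proof.
have cid := @continuous_idf 'rV[R]_n.+1.
rewrite (_ : reverse_fun f =
  f \o (fun t : 'rV[R]_n.+1 => set_coord0 t (1 - t 0 0))) //.
apply: continuous_within_comp (spheroid_continuous f).
  apply: set_coord0_continuous => //.
  exact: continuous_subf (@continuous_cstf _ _ 1) (coord0_continuous cid).
move=> t ct; have /andP[t0 t1] := ct 0.
by apply: cube_set_coord0 => //; lra.
Qed.

Definition reverse f : spheroid n.+1 :=
  Spheroid (@reverse_fun_continuous f) (@reverse_fun_boundary f).

Lemma homotopic_concat f f' g g' :
  homotopic f f' -> homotopic g g' -> homotopic (concat f g) (concat f' g').
Proof.
move=> [H [cH H0 H1 Hb]] [K [cK K0 K1 Kb]].
exists (fun p : 'rV[R]_n.+1 * R => if p.1 0 0 <= 2^-1 then H (set_coord0 p.1 (2 * p.1 0 0), p.2)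
                 else K (set_coord0 p.1 (2 * p.1 0 0 - 1), p.2)).
have cfst : continuous (@fst 'rV[R]_n.+1 R) by move=> ?; exact: cvg_fst.
have cfst0 : continuous (fun p : 'rV[R]_n.+1 * R => p.1 0 0).
  exact: coord0_continuous.
split.
- apply: (@continuous_within_if R _ _ _ (fun p : 'rV[R]_n.+1 * R => p.1 0 0)) => //.
  + apply: (continuous_within_comp
      (f := fun p : 'rV[R]_n.+1 * R => (set_coord0 p.1 (2 * p.1 0 0), p.2)) _ _ cH).
      apply: continuous_pair => [|p]; last exact: cvg_snd.
      apply: (set_coord0_continuous cfst).
      exact: continuous_mulf (@continuous_cstf _ _ 2) cfst0.
    move=> [t s] [] [/= ct s01] h; have /andP[t0 t1] := ct 0.
    by split => //=; apply: cube_set_coord0 => //; lra.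
  + apply: (continuous_within_comp
      (f := fun p : 'rV[R]_n.+1 * R => (set_coord0 p.1 (2 * p.1 0 0 - 1), p.2)) _ _ cK).
      apply: continuous_pair => [|p]; last exact: cvg_snd.
      apply: (set_coord0_continuous cfst).
      apply: continuous_subf; last exact: continuous_cstf.
      exact: continuous_mulf (@continuous_cstf _ _ 2) cfst0.
    move=> [t s] [] [/= ct s01] h; have /andP[t0 t1] := ct 0.
    by split => //=; apply: cube_set_coord0 => //; lra.
  + move=> [t s] [/= ct s01] t2.
    rewrite Hb ?Kb //; apply: boundary_set_coord0 => //; first by left; lra.
    by right; lra.
- move=> t ct /=; have /andP[t0 t1] := ct 0; rewrite /concat_fun.
  case: ifPn => [h|]; last rewrite -ltNge => h.
    by rewrite H0 //; apply: cube_set_coord0 => //; lra.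
  by rewrite K0 //; apply: cube_set_coord0 => //; lra.
- move=> t ct /=; have /andP[t0 t1] := ct 0; rewrite /concat_fun.
  case: ifPn => [h|]; last rewrite -ltNge => h.
    by rewrite H1 //; apply: cube_set_coord0 => //; lra.
  by rewrite K1 //; apply: cube_set_coord0 => //; lra.
- move=> t s bt s01 /=; have /andP[t0 t1] := bt.1 0.
  case: ifPn => [h|]; last rewrite -ltNge => h.
    by apply: Hb => //; apply: boundary_set_coord0_or => //; lra.
  by apply: Kb => //; apply: boundary_set_coord0_or => //; lra.
Qed.

Lemma homotopic_reverse f g :
  homotopic f g -> homotopic (reverse f) (reverse g).
Proof.
move=> [H [cH H0 H1 Hb]].
exists (fun p : 'rV[R]_n.+1 * R => H (set_coord0 p.1 (1 - p.1 0 0), p.2)).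
have cfst : continuous (@fst 'rV[R]_n.+1 R) by move=> ?; exact: cvg_fst.
have cfst0 : continuous (fun p : 'rV[R]_n.+1 * R => p.1 0 0).
  exact: coord0_continuous.
split.
- apply: (continuous_within_comp
    (f := fun p : 'rV[R]_n.+1 * R => (set_coord0 p.1 (1 - p.1 0 0), p.2)) _ _ cH).
    apply: continuous_pair => [|p]; last exact: cvg_snd.
    apply: (set_coord0_continuous cfst).
    exact: continuous_subf (@continuous_cstf _ _ 1) cfst0.
  move=> [t s] [/= ct s01]; have /andP[t0 t1] := ct 0.
  by split => //=; apply: cube_set_coord0 => //; lra.
- move=> t ct /=; have /andP[t0 t1] := ct 0.
  by rewrite H0 //; apply: cube_set_coord0 => //; lra.
- move=> t ct /=; have /andP[t0 t1] := ct 0.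
  by rewrite H1 //; apply: cube_set_coord0 => //; lra.
- move=> t s bt s01 /=; have /andP[t0 t1] := bt.1 0.
  by apply: Hb => //; apply: boundary_set_coord0_or => //; lra.
Qed.

Lemma homotopic_reparametrization (F f g : spheroid n.+1) (a b : R -> R) :
  continuous a -> continuous b ->
  (forall s, 0 <= s <= 1 -> 0 <= a s <= 1) ->
  (forall s, 0 <= s <= 1 -> 0 <= b s <= 1) ->
  a 0 = b 0 -> a 1 = b 1 -> (b 0 = 0 \/ b 0 = 1) -> (b 1 = 0 \/ b 1 = 1) ->
  (forall t, cube t -> f t = F (set_coord0 t (a (t 0 0)))) ->
  (forall t, cube t -> g t = F (set_coord0 t (b (t 0 0)))) ->
  homotopic f g.
Proof.
move=> ca cb a01 b01 ab0 ab1 b0 b1 fE gE.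
pose m (p : 'rV[R]_n.+1 * R) := (1 - p.2) * a (p.1 0 0) + p.2 * b (p.1 0 0).
have m01 t s : cube t -> 0 <= s <= 1 -> 0 <= m (t, s) <= 1.
  move=> ct /andP[s0 s1]; rewrite /m /=.
  have /andP[a0' a1'] := a01 _ (ct 0); have /andP[b0' b1'] := b01 _ (ct 0).
  move: (a _) (b _) a0' a1' b0' b1' => u v u0 u1 v0 v1.
  by apply/andP; split; nra.
have csnd : continuous (@snd 'rV[R]_n.+1 R) by move=> ?; exact: cvg_snd.
exists (fun p : 'rV[R]_n.+1 * R => F (set_coord0 p.1 (m p))).
have cfst : continuous (@fst 'rV[R]_n.+1 R) by move=> ?; exact: cvg_fst.
have cfst0 : continuous (fun p : 'rV[R]_n.+1 * R => p.1 0 0).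
  exact: coord0_continuous.
split.
- apply: (@continuous_within_comp _ _ _ _ _
    (fun p : 'rV[R]_n.+1 * R => set_coord0 p.1 (m p)) F _ _ (spheroid_continuous F)).
    apply: (set_coord0_continuous cfst).
    apply: continuous_addf; apply: continuous_mulf.
    + exact: continuous_subf (@continuous_cstf _ _ 1) csnd.
    + by move=> p; apply: (@continuous_comp _ _ _ _ a p (cfst0 p)); exact: ca.
    + exact: csnd.
    + by move=> p; apply: (@continuous_comp _ _ _ _ b p (cfst0 p)); exact: cb.
  by move=> [t s] [/= ct s01]; apply: cube_set_coord0 => //; exact: m01.
- by move=> t ct; rewrite /m /= subr0 mul1r mul0r addr0 fE.
- by move=> t ct; rewrite /m /= subrr mul1r mul0r add0r gE.
- move=> t s bt s01; have ct := bt.1.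
  apply/spheroid_boundary/boundary_set_coord0_or => //; first exact: m01.
    by rewrite /m /= => ->; rewrite ab0 -mulrDl subrK mul1r.
  by rewrite /m /= => ->; rewrite ab1 -mulrDl subrK mul1r.
Qed.

Lemma homotopic_eq f g : (forall t, cube t -> f t = g t) -> homotopic f g.
Proof.
move=> fg; have cid : continuous (@idfun R) by move=> ?; exact: cvg_id.
apply: (@homotopic_reparametrization g f g id id) => //; [by left|by right|..].
  by move=> t ct; rewrite set_coord0_id fg.
by move=> t ct; rewrite set_coord0_id.
Qed.

Let cont_affine (a b : R) : continuous (fun s : R => a * s + b).
Proof.
move=> s; apply: cvgD; last exact: cvg_cst.
by apply: cvgM; [exact: cvg_cst|exact: cvg_id].
Qed.

Let cont_min (a b : R -> R) : continuous a -> continuous b ->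
  continuous (fun s => Num.min (a s) (b s)).
Proof. by move=> ca cb s; apply: continuous_min; [exact: ca|exact: cb]. Qed.

Let min_cases (u v : R) :
  u <= v /\ Num.min u v = u \/ v <= u /\ Num.min u v = v.
Proof. by case: (leP u v) => uv; [left|right; rewrite ltW]. Qed.

Let min3_cases (u v w : R) (m := Num.min u (Num.min v w)) :
  [/\ m <= u, m <= v, m <= w & m = u \/ m = v \/ m = w].
Proof.
rewrite /m; have [[? ->]|[? ->]] := min_cases v w.
  have [[? ->]|[? ->]] := min_cases u v; split => //; try lra; tauto.
have [[? ->]|[? ->]] := min_cases u w; split => //; try lra; tauto.
Qed.

Lemma homotopic_concatA f g h :
  homotopic (concat f (concat g h)) (concat (concat f g) h).
Proof.
apply: homotopic_sym.
have cid : continuous (@idfun R) by move=> ?; exact: cvg_id.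
pose a s : R := Num.min (2 * s + 0) (Num.min (1 * s + 4^-1) (2^-1 * s + 2^-1)).
have aP s : [/\ a s <= 2 * s + 0, a s <= 1 * s + 4^-1,
    a s <= 2^-1 * s + 2^-1 & a s = 2 * s + 0 \/ a s = 1 * s + 4^-1 \/
    a s = 2^-1 * s + 2^-1] by exact: min3_cases.
have aE1 s : s <= 4^-1 -> a s = 2 * s.
  move=> s4; have [? ? ? [|[]]] := aP s; lra.
have aE2 s : 4^-1 <= s -> s <= 2^-1 -> a s = s + 4^-1.
  move=> s4 s2; have [? ? ? [|[]]] := aP s; lra.
have aE3 s : 2^-1 <= s -> a s = 2^-1 * s + 2^-1.
  move=> s2; have [? ? ? [|[]]] := aP s; lra.
apply: (@homotopic_reparametrization (concat f (concat g h)) _ _ a id) => //.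
- by apply: cont_min; [|apply: cont_min]; exact: cont_affine.
- move=> s /andP[s0 s1]; have [? ? ? [|[]]] := aP s; lra.
- by rewrite aE1 ?mulr0 // invr_ge0 ler0n.
- by rewrite aE3; lra.
- by left.
- by right.
- move=> t ct; have /andP[t0 t1] := ct 0.
  rewrite /= /concat_fun /= /concat_fun !set_coord0E !set_coord0_idem.
  have [h1|h1] := leP (t 0 0) 4^-1.
    by rewrite aE1 // !ifT; [|lra..].
  have [h2|h2] := leP (t 0 0) 2^-1.
    rewrite aE2 ?(ltW h1) //.
    rewrite (_ : (t 0 0 + 4^-1 <= 2^-1) = false);
      last by apply/negbTE; rewrite -ltNge; lra.
    rewrite (_ : (2 * t 0 0 <= 2^-1) = false);
      last by apply/negbTE; rewrite -ltNge; lra.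
    rewrite ifT; last by lra.
    by congr (g (set_coord0 _ _)); lra.
  rewrite aE3 ?(ltW h2) //.
  rewrite (_ : (2^-1 * t 0 0 + 2^-1 <= 2^-1) = false);
      last by apply/negbTE; rewrite -ltNge; lra.
  rewrite ifF;
      last by apply/negbTE; rewrite -ltNge; lra.
  by congr (h (set_coord0 _ _)); lra.
- by move=> t ct; rewrite set_coord0_id.
Qed.

Lemma homotopic_concat1f f : homotopic (concat (constant_spheroid _) f) f.
Proof.
have cid : continuous (@idfun R) by move=> ?; exact: cvg_id.
pose a s : R := - Num.min (- 2 * s + 1) (0 * s + 0).
apply: (@homotopic_reparametrization f _ _ a id) => //.
- move=> s; apply: cvgN.
  exact: (cont_min (@cont_affine (- 2) 1) (@cont_affine 0 0)).
- by move=> s /andP[s0 s1]; rewrite /a;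
    have [[? ->]|[? ->]] := min_cases (- 2 * s + 1) (0 * s + 0); lra.
- by rewrite /a;
    have [[? ->]|[? ->]] := min_cases (- 2 * 0 + 1) (0 * 0 + 0); lra.
- by rewrite /a;
    have [[? ->]|[? ->]] := min_cases (- 2 * 1 + 1) (0 * 1 + 0); lra.
- by left.
- by right.
- move=> t ct; have /andP[t0 t1] := ct 0; rewrite /= /concat_fun /=.
  case: ifPn => [h|]; last rewrite -ltNge => h.
    rewrite spheroid_boundary //; apply: boundary_set_coord0 => //.
    by left; rewrite /a;
    have [[? ->]|[? ->]] := min_cases (- 2 * t 0 0 + 1) (0 * t 0 0 + 0); lra.
  by congr (f (set_coord0 _ _)); rewrite /a;
    have [[? ->]|[? ->]] := min_cases (- 2 * t 0 0 + 1) (0 * t 0 0 + 0); lra.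
- by move=> t ct; rewrite set_coord0_id.
Qed.

Lemma homotopic_concatf1 f : homotopic (concat f (constant_spheroid _)) f.
Proof.
have cid : continuous (@idfun R) by move=> ?; exact: cvg_id.
pose a s : R := Num.min (2 * s + 0) (0 * s + 1).
apply: (@homotopic_reparametrization f _ _ a id) => //.
- by apply: cont_min; exact: cont_affine.
- by move=> s /andP[s0 s1]; rewrite /a;
    have [[? ->]|[? ->]] := min_cases (2 * s + 0) (0 * s + 1); lra.
- by rewrite /a;
    have [[? ->]|[? ->]] := min_cases (2 * 0 + 0) (0 * 0 + 1); lra.
- by rewrite /a;
    have [[? ->]|[? ->]] := min_cases (2 * 1 + 0) (0 * 1 + 1); lra.
- by left.
- by right.
- move=> t ct; have /andP[t0 t1] := ct 0; rewrite /= /concat_fun /=.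
  case: ifPn => [h|]; last rewrite -ltNge => h.
    by congr (f (set_coord0 _ _)); rewrite /a;
    have [[? ->]|[? ->]] := min_cases (2 * t 0 0 + 0) (0 * t 0 0 + 1); lra.
  rewrite spheroid_boundary //; apply: boundary_set_coord0 => //.
  by right; rewrite /a;
    have [[? ->]|[? ->]] := min_cases (2 * t 0 0 + 0) (0 * t 0 0 + 1); lra.
- by move=> t ct; rewrite set_coord0_id.
Qed.

Lemma homotopic_concatfV f :
  homotopic (concat f (reverse f)) (constant_spheroid _).
Proof.
pose a s : R := Num.min (2 * s + 0) (- 2 * s + 2).
apply: (@homotopic_reparametrization f _ _ a (fun=> 0)) => //.
- by apply: cont_min; exact: cont_affine.
- by move=> s; exact: cvg_cst.
- by move=> s /andP[s0 s1]; rewrite /a;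
    have [[? ->]|[? ->]] := min_cases (2 * s + 0) (- 2 * s + 2); lra.
- by move=> s _; rewrite lexx ler01.
- by rewrite /a;
    have [[? ->]|[? ->]] := min_cases (2 * 0 + 0) (- 2 * 0 + 2); lra.
- by rewrite /a;
    have [[? ->]|[? ->]] := min_cases (2 * 1 + 0) (- 2 * 1 + 2); lra.
- by left.
- by left.
- move=> t ct; have /andP[t0 t1] := ct 0; rewrite /= /concat_fun /= /reverse_fun.
  rewrite set_coord0_idem set_coord0E.
  case: ifPn => [h|]; last rewrite -ltNge => h.
    by congr (f (set_coord0 _ _)); rewrite /a;
    have [[? ->]|[? ->]] := min_cases (2 * t 0 0 + 0) (- 2 * t 0 0 + 2); lra.
  by congr (f (set_coord0 _ _)); rewrite /a;
    have [[? ->]|[? ->]] := min_cases (2 * t 0 0 + 0) (- 2 * t 0 0 + 2); lra.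
- move=> t ct; apply/esym/spheroid_boundary/boundary_set_coord0 => //.
  by left.
Qed.

Lemma homotopic_reverseK f : homotopic (reverse (reverse f)) f.
Proof.
apply: homotopic_eq => t _ /=; rewrite /reverse_fun set_coord0_idem set_coord0E.
by rewrite subKr set_coord0_id.
Qed.

Lemma homotopic_concatVf f :
  homotopic (concat (reverse f) f) (constant_spheroid _).
Proof.
apply: homotopic_trans (homotopic_concatfV (reverse f)).
by apply: homotopic_concat; [exact: homotopic_refl|exact/homotopic_sym/homotopic_reverseK].
Qed.

Definition homotopy_group_one : homotopy_group n.+1 :=
  homotopy_class (constant_spheroid _).
Definition homotopy_group_inv (a : homotopy_group n.+1) : homotopy_group n.+1 :=
  homotopy_class (reverse (repr a)).
Definition homotopy_group_mul (a b : homotopy_group n.+1) : homotopy_group n.+1 :=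
  homotopy_class (concat (repr a) (repr b)).

Lemma homotopy_group_mul_class f g :
  homotopy_group_mul (homotopy_class f) (homotopy_class g) =
  homotopy_class (concat f g).
Proof.
apply/homotopy_classP/homotopic_concat; apply/homotopy_classP;
  exact: homotopy_class_repr.
Qed.

Lemma homotopy_group_inv_class f :
  homotopy_group_inv (homotopy_class f) = homotopy_class (reverse f).
Proof.
apply/homotopy_classP/homotopic_reverse; apply/homotopy_classP.
exact: homotopy_class_repr.
Qed.

Lemma homotopy_group_mulA : associative homotopy_group_mul.
Proof.
move=> a b c; rewrite -(homotopy_class_repr a) -(homotopy_class_repr b).
rewrite -(homotopy_class_repr c) !homotopy_group_mul_class.
exact/homotopy_classP/homotopic_concatA.
Qed.

Lemma homotopy_group_mul1g : left_id homotopy_group_one homotopy_group_mul.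
Proof.
move=> a; rewrite -(homotopy_class_repr a) homotopy_group_mul_class.
exact/homotopy_classP/homotopic_concat1f.
Qed.

Lemma homotopy_group_mulg1 : right_id homotopy_group_one homotopy_group_mul.
Proof.
move=> a; rewrite -(homotopy_class_repr a) homotopy_group_mul_class.
exact/homotopy_classP/homotopic_concatf1.
Qed.

Lemma homotopy_group_mulVg :
  left_inverse homotopy_group_one homotopy_group_inv homotopy_group_mul.
Proof.
move=> a; rewrite -(homotopy_class_repr a) homotopy_group_inv_class.
rewrite homotopy_group_mul_class.
exact/homotopy_classP/homotopic_concatVf.
Qed.

Lemma homotopy_group_mulgV :
  right_inverse homotopy_group_one homotopy_group_inv homotopy_group_mul.
Proof.
move=> a; rewrite -(homotopy_class_repr a) homotopy_group_inv_class.
rewrite homotopy_group_mul_class.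
exact/homotopy_classP/homotopic_concatfV.
Qed.

HB.instance Definition _ := isGroup.Build (homotopy_group n.+1)
  homotopy_group_mulA homotopy_group_mul1g homotopy_group_mulg1
  homotopy_group_mulVg homotopy_group_mulgV.

End Concatenation.
End HomotopyGroups.

(* Main.v *)
Require Import Defs.
From HB Require Import structures.
From mathcomp Require Import all_boot all_order all_algebra ring lra complex.
From mathcomp Require Import boolp classical_sets functions cardinality.
From mathcomp Require Import interval_inference reals topology normedtype.
From mathcomp Require Import landau derive.

(** The manifold is a complexified Margulis space-time: the quotient of C^3 by
    a free group that acts freely and properly discontinuously by complex
    affine maps.

    Such a quotient has the required properties whatever the action is. It is
    covered by the contractible space C^3, so it is aspherical and its
    fundamental group is the acting group ([pi1_isomorphic] and
    [higher_homotopy_trivial], both resting on [homotopy_lifting]). It is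
    elliptic because an affine map [v |-> L v + c] takes [v + u] to its value at
    [v] plus [L u]: the spray [(v, u) |-> v + u] of C^3 is equivariant, and
    descends to the quotient of C^3 x C^3 by the action and its linear parts,
    which is a vector bundle over the quotient of C^3
    ([affine_quotient_elliptic]).

    The point is therefore to find the action. Take C^3 to be sl_2(C). If a free
    group of matrices [g] of determinant 1 is moved along a deformation, with
    derivative [g'] at the start, then [v |-> g v g^-1 + g' g^-1] is an affine
    action, and the image [w] of [v] satisfies [w g = g v + g']. Hence
    [|g'| <= (|v| + |w|) |g|], and the action is proper as soon as [|g'| / |g|]
    tends to infinity with [g]. This says that the logarithm of the norm of
    every long word varies quickly along the deformation. It holds for two
    hyperbolic matrices with eigenvalues 8 and 1/8, one diagonal and one with
    eigenvectors (1,1) and (1,-1), when both eigenvalues are multiplied by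
    [e^t] and [e^-t]: a reduced word expands every vector of a suitable cone by
    about 8 for each letter, and a ping-pong argument shows that the derivative
    of a word of length [n] is at least [n / 2] times the word on that cone
    ([growth_step], [displacement_bound]). The two matrices are real, so it is
    enough to bound the displacement of real parts.

    A fixed point would bound the lengths of all the powers of a cyclically
    reduced word, so the action is free ([word_act_free]). A free group on
    countably many generators [x_i] acts through the words [b^i a b^-i], which
    generate a free subgroup ([expand_reduced]). *)

Set Implicit Arguments.
Unset Strict Implicit.
Unset Printing Implicit Defensive.

Import Order.TTheory GRing.Theory Num.Theory.
Import numFieldNormedType.Exports.

Local Open Scope classical_set_scope.
Local Open Scope ring_scope.
Local Open Scope quotient_scope.
Local Open Scope complex_scope.

(** * Growth of reduced words in two hyperbolic matrices *)

(** The pairs [(true, _)] stand for the diagonal generator [b] and its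
    inverse, the pairs [(false, _)] for the generator [a] and its inverse; the
    second component is [true] for the generator itself, as in [word]. *)
Definition letter := (bool * bool)%type.
Definition letter_inv (x : letter) : letter := (x.1, ~~ x.2).
Definition noncancelling (x y : letter) := y != letter_inv x.
Definition reduced := sorted noncancelling.

Section PingPong.
Variable R : realFieldType.
Implicit Types (u z g h : R * R) (x y : letter) (w : seq letter).

(** The action on column vectors of the matrix of a letter: [b] is
    [diag(8, 1/8)], and [a] is symmetric with the eigenvalue 8 on [(1, 1)] and
    1/8 on [(1, -1)]. *)
Definition letter_mx x u : R * R :=
  match x with
  | (true, true) => (8 * u.1, 8^-1 * u.2)
  | (true, false) => (8^-1 * u.1, 8 * u.2)
  | (false, true) => ((8 + 8^-1) / 2 * u.1 + (8 - 8^-1) / 2 * u.2,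
                      (8 - 8^-1) / 2 * u.1 + (8 + 8^-1) / 2 * u.2)
  | (false, false) => ((8 + 8^-1) / 2 * u.1 - (8 - 8^-1) / 2 * u.2,
                       - ((8 - 8^-1) / 2) * u.1 + (8 + 8^-1) / 2 * u.2)
  end.

(** The logarithmic derivative of [letter_mx] when the eigenvalues
    are multiplied by [e^t] and [e^-t]: the reflection that fixes the expanding
    axis of the letter and negates the contracting one. *)
Definition letter_gen x u : R * R :=
  match x with
  | (true, true) => (u.1, - u.2)
  | (true, false) => (- u.1, u.2)
  | (false, true) => (u.2, u.1)
  | (false, false) => (- u.2, - u.1)
  end.

Definition addp u z : R * R := (u.1 + z.1, u.2 + z.2).

Definition word_mx w u := foldr letter_mx u w.

(** The product rule for the derivative of the matrix of a word. *)
Fixpoint word_der w u : R * R :=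
  if w is x :: w' then
    addp (letter_mx x (word_der w' u)) (letter_gen x (letter_mx x (word_mx w' u)))
  else (0, 0).

(** An eigenvector for the eigenvalue 8. The eigenvector for 1/8 is the
    axis of the inverse letter, and the two are orthogonal, so that
    [expanding x] and [contracting x] are, up to a common factor, coordinates in
    the eigenbasis of [x]. *)
Definition axis x : R * R :=
  match x with
  | (true, true) => (1, 0)
  | (true, false) => (0, 1)
  | (false, true) => (1, 1)
  | (false, false) => (1, -1)
  end.

Definition dotp u z : R := u.1 * z.1 + u.2 * z.2.

Lemma dotpC u z : dotp u z = dotp z u.
Proof. by rewrite /dotp mulrC [u.2 * _]mulrC. Qed.

Definition expanding x u := dotp (axis x) u.
Definition contracting x u := expanding (letter_inv x) u.

Lemma expanding_letter x u : expanding x (letter_mx x u) = 8 * expanding x u.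
Proof. by case: x => -[] []; rewrite /expanding /dotp /=; lra. Qed.

Lemma contracting_letter x u : contracting x (letter_mx x u) = 8^-1 * contracting x u.
Proof. by case: x => -[] []; rewrite /contracting /expanding /dotp /=; lra. Qed.

Lemma expanding_gen x u : expanding x (letter_gen x u) = expanding x u.
Proof. by case: x => -[] []; rewrite /expanding /dotp /=; lra. Qed.

Lemma contracting_gen x u : contracting x (letter_gen x u) = - contracting x u.
Proof. by case: x => -[] []; rewrite /contracting /expanding /dotp /=; lra. Qed.

Lemma expanding_addp x u z : expanding x (addp u z) = expanding x u + expanding x z.
Proof. by rewrite /expanding /dotp /=; ring. Qed.

Lemma contracting_addp x u z : contracting x (addp u z) = contracting x u + contracting x z.
Proof. exact: expanding_addp. Qed.

(** The eigenbases of [a] and [b] make an angle of 45 degrees, so all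
    four coefficients of the change of coordinates have the same size. No
    vector of the cone of one generator is close to the contracting axis of
    the other. *)
Lemma change_axis x y : x.1 != y.1 -> exists k k1 k2 k3 k4 : R,
  [/\ 0 < k, [/\ `|k1| = k, `|k2| = k, `|k3| = k & `|k4| = k],
   forall u, expanding x u = k1 * expanding y u + k2 * contracting y u
   & forall u, contracting x u = k3 * expanding y u + k4 * contracting y u].
Proof.
have n1 : `|1| = 1 :> R by rewrite normr1.
have n1' : `|-1| = 1 :> R by rewrite normrN1.
have n2 : `|2^-1| = 2^-1 :> R by rewrite ger0_norm ?invr_ge0.
have n2' : `|- 2^-1| = 2^-1 :> R by rewrite normrN.
case: x y => [[] []] [[] []] //= _;
  [exists 2^-1, 2^-1, 2^-1, 2^-1, (- 2^-1)|exists 2^-1, 2^-1, 2^-1, (- 2^-1), 2^-1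
  |exists 2^-1, 2^-1, (- 2^-1), 2^-1, 2^-1|exists 2^-1, (- 2^-1), 2^-1, 2^-1, 2^-1
  |exists 1, 1, 1, 1, (-1)|exists 1, 1, 1, (-1), 1
  |exists 1, 1, (-1), 1, 1|exists 1, (-1), 1, 1, 1];
  (split; [lra|by split|move=> u|move=> u]);
  rewrite /contracting /expanding /dotp /=; lra.
Qed.

Definition in_cone x g := expanding x g != 0 /\ `|contracting x g| <= 2^-1 * `|expanding x g|.

(** The vector [g] stands for the image of a vector by a word that begins
    with [x], and [h] for its derivative. Up to a small error along the
    contracting axis, the derivative is [r] times the image. *)
Definition growth x (r : R) g h :=
  [/\ in_cone x g, expanding x h = r * expanding x g
    & `|contracting x h - r * contracting x g| <= 4^-1 * `|expanding x g|].

(** Ping-pong. The letter [x] multiplies the expanding coordinate by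
    8 and divides the contracting one by 8, which restores the two bounds of
    [growth] after the loss due to the change of eigenbasis. It contributes 1
    to [r] by its own derivative, and the error term of the previous step
    spoils at most 1/2 of it. *)
Lemma growth_step x y r g h : noncancelling x y -> growth y r g h ->
  exists2 r', r + 2^-1 <= r' &
    growth x r' (letter_mx x g)
      (addp (letter_mx x h) (letter_gen x (letter_mx x g))).
Proof.
move=> xy [[p0 qp] hp he]; have [x1y1|/change_axis] := eqVneq x.1 y.1.
  have xEy : x = y.
    by case: x y xy x1y1 {p0 qp hp he} => [[] []] [[] []].
  subst y; exists (r + 1); first lra.
  split; first split.
  - by rewrite expanding_letter mulf_neq0 ?pnatr_eq0.
  - rewrite contracting_letter expanding_letter !normrM ger0_norm ?invr_ge0 // [`|8|]ger0_norm //.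
    have := normr_ge0 (expanding x g); lra.
  - rewrite expanding_addp expanding_gen !expanding_letter hp; ring.
  - rewrite contracting_addp contracting_gen !contracting_letter expanding_letter.
    rewrite (_ : _ - _ =
      8^-1 * ((contracting x h - r * contracting x g) - 2 * contracting x g)); last by field.
    rewrite !normrM ger0_norm ?invr_ge0 // [`|8|]ger0_norm //.
    have := ler_normB (contracting x h - r * contracting x g) (2 * contracting x g).
    rewrite normrM [`|2|]ger0_norm //.
    have := normr_ge0 (expanding x g); lra.
move=> [k [k1 [k2 [k3 [k4 [k0 [e1 e2 e3 e4] dE rE]]]]]].
set p := expanding y g in p0 qp hp he *; set q := contracting y g in qp he *.
set e := contracting y h - r * q in he.
have hq : contracting y h = r * q + e by rewrite /e; ring.
have PE : expanding x g = k1 * p + k2 * q by exact: dE.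
have QE : contracting x g = k3 * p + k4 * q by exact: rE.
set P := expanding x g in PE; set Q := contracting x g in QE.
have p_gt0 : 0 < `|p| by rewrite normr_gt0.
have kp : 0 < k * `|p| by rewrite mulr_gt0.
have P_ge : k * `|p| <= 2 * `|P|.
  have := ler_normB (k1 * p + k2 * q) (k2 * q); rewrite addrK -PE !normrM e1 e2.
  have : k * `|q| <= k * (2^-1 * `|p|) by rewrite ler_pM2l.
  lra.
have Q_le : `|Q| <= 3 / 2 * (k * `|p|).
  have := ler_normD (k3 * p) (k4 * q); rewrite -QE !normrM e3 e4.
  have : k * `|q| <= k * (2^-1 * `|p|) by rewrite ler_pM2l.
  lra.
have P_gt0 : 0 < `|P| by lra.
have P0 : P != 0 by rewrite -normr_gt0.
have ke i : `|i| = k -> `|i * e| <= 4^-1 * (k * `|p|).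
  move=> ik; rewrite normrM ik.
  have : k * `|e| <= k * (4^-1 * `|p|) by rewrite ler_pM2l.
  lra.
(* The error term of the previous step changes the ratio [r] by [t]. *)
set t := k2 * e / P.
have tP : t * P = k2 * e by rewrite /t mulfVK.
have t_le : `|t| <= 2^-1.
  rewrite /t normrM normfV ler_pdivrMr //; have := ke _ e2; lra.
have /andP[t_ge _] : - 2^-1 <= t <= 2^-1 by rewrite -ler_norml.
have hP : expanding x h = r * P + k2 * e by rewrite dE hp hq PE; ring.
have hQ : contracting x h = r * Q + k4 * e by rewrite rE hp hq QE; ring.
have tQ : `|t * Q| <= 2^-1 * (3 / 2 * (k * `|p|)).
  by rewrite normrM ler_pM.
exists (r + 1 + t); first lra.
split; first split.
- by rewrite expanding_letter mulf_neq0 ?pnatr_eq0.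
- rewrite contracting_letter expanding_letter !normrM ger0_norm ?invr_ge0 // [`|8|]ger0_norm //.
  rewrite -/P -/Q; lra.
- rewrite expanding_addp expanding_gen !expanding_letter hP -/P -tP; ring.
- rewrite contracting_addp contracting_gen !contracting_letter expanding_letter hQ -/P -/Q.
  rewrite (_ : _ - _ = 8^-1 * (k4 * e - 2 * Q - t * Q)); last by ring.
  rewrite !normrM ger0_norm ?invr_ge0 // [`|8|]ger0_norm //.
  have := ler_normB (k4 * e - 2 * Q) (t * Q).
  have := ler_normB (k4 * e) (2 * Q).
  rewrite [`|2 * Q|]normrM [`|2|]ger0_norm //.
  have := ke _ e4; lra.
Qed.

Lemma axis_growth x :
  growth x 1 (letter_mx x (axis x)) (word_der [:: x] (axis x)).
Proof.
have d0 : expanding x (axis x) != 0.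
  by apply: lt0r_neq0; case: x => -[] []; rewrite /expanding /dotp /=; lra.
have r0 : contracting x (axis x) = 0.
  by case: x {d0} => -[] []; rewrite /contracting /expanding /dotp /=; lra.
have l0 : letter_mx x (0, 0) = (0, 0) by case: x {d0 r0} => -[] []; congr (_, _) => /=; ring.
rewrite /= l0; split; first split.
- by rewrite expanding_letter mulf_neq0 ?pnatr_eq0.
- by rewrite contracting_letter r0 mulr0 normr0 mulr_ge0 // invr_ge0.
- by rewrite expanding_addp expanding_gen mul1r /expanding /dotp /=; ring.
- have z0 : contracting x (0, 0) = 0 by rewrite /contracting /expanding /dotp /= !mulr0 addr0.
  rewrite contracting_addp contracting_gen !contracting_letter r0 z0 !mulr0 oppr0 !addr0 normr0.
  by rewrite mulr_ge0 // invr_ge0.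
Qed.

Lemma word_growth x w : reduced (x :: w) ->
  exists2 r, (size (x :: w))%:R / 2 <= r &
    growth x r (word_mx (x :: w) (axis (last x w)))
      (word_der (x :: w) (axis (last x w))).
Proof.
elim: w x => [|y w IH] x; first by move=> _; exists 1; [rewrite /=; lra|exact: axis_growth].
move=> /= /andP[xy yw]; have [r rn gr] := IH _ yw.
have [r' rr' gr'] := growth_step xy gr; exists r' => //.
by rewrite /= -addn1 natrD; move: rn => /=; lra.
Qed.

Lemma dotp_letter x u z : dotp (letter_mx x u) z = dotp u (letter_mx x z).
Proof. by case: x => -[] []; rewrite /dotp /=; ring. Qed.

(** The letters are symmetric matrices, so the transpose of a word is the
    reversed word; bounds on the columns of a word thus give bounds on its
    rows. *)
Lemma dotp_word w u z : dotp (word_mx w u) z = dotp u (word_mx (rev w) z).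
Proof.
elim/last_ind: w u z => [|w x IH] u z //.
rewrite rev_rcons /= -dotp_letter -[in RHS]/(word_mx (rev w) z).
by rewrite /word_mx -cats1 foldr_cat -[foldr _ _ w]/(word_mx w _) IH /= dotp_letter.
Qed.

Lemma rev_reduced w : reduced w -> reduced (rev w).
Proof.
rewrite /reduced rev_sorted; congr is_true; apply: eq_sorted => x y.
rewrite /noncancelling /letter_inv.
by case: x y => [[] []] [[] []].
Qed.

Lemma cone_bound x g : in_cone x g ->
  `|g.1| <= 3 / 2 * `|expanding x g| /\ `|g.2| <= 3 / 2 * `|expanding x g|.
Proof.
move=> [_ hr].
have [d [r [dE rE gE]]] : exists d r, [/\ expanding x g = d, contracting x g = r &
  [\/ g = (d, r), g = (r, d), g = ((d + r) / 2, (d - r) / 2) | g = ((d + r) / 2, (r - d) / 2)]].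
  exists (expanding x g), (contracting x g); split=> //.
  case: g {hr} => g1 g2; rewrite /contracting /expanding /dotp /=.
  case: x => -[] [] /=; [apply: Or41|apply: Or42|apply: Or43|apply: Or44]; congr (_, _); lra.
rewrite dE rE in hr *.
have := ler_normD d r; have := ler_normB d r; have := distrC d r.
have := normr_ge0 d; have := normr_ge0 r.
by case: gE => -> /=; rewrite ?normrM ?[`|2^-1|]ger0_norm ?invr_ge0 //; split; lra.
Qed.

(** The traceless matrix with rows [(Z, X + Y)] and [(X - Y, - Z)]. In
    these coordinates the determinant is [Y^2 - X^2 - Z^2] and both generators
    act by Lorentz boosts. *)
Definition sl2_apply (X Y Z : R) u : R * R :=
  (Z * u.1 + (X + Y) * u.2, (X - Y) * u.1 - Z * u.2).

Lemma sl2_apply_bound (X Y Z B C : R) u :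
  `|X| <= B -> `|Y| <= B -> `|Z| <= B -> `|u.1| <= C -> `|u.2| <= C ->
  `|(sl2_apply X Y Z u).1| <= 3 * (B * C) /\ `|(sl2_apply X Y Z u).2| <= 3 * (B * C).
Proof.
move=> hX hY hZ h1 h2.
have m a b : `|a| <= B -> `|b| <= C -> `|a * b| <= B * C.
  by move=> ha hb; rewrite normrM ler_pM.
rewrite /sl2_apply /=; split.
- rewrite mulrDl; apply: le_trans (ler_normD _ _) _.
  apply: le_trans (lerD (lexx _) (ler_normD _ _)) _.
  have := m _ _ hZ h1; have := m _ _ hX h2; have := m _ _ hY h2; lra.
- rewrite mulrBl; apply: le_trans (ler_normB _ _) _.
  apply: le_trans (lerD (ler_normB _ _) (lexx _)) _.
  have := m _ _ hZ h2; have := m _ _ hX h1; have := m _ _ hY h1; lra.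
Qed.

Lemma dotp_bound u z (A B : R) : `|u.1| <= A -> `|u.2| <= A -> `|z.1| <= B -> `|z.2| <= B ->
  `|dotp u z| <= 2 * (A * B).
Proof.
move=> u1 u2 z1 z2; apply: le_trans (ler_normD _ _) _; rewrite !normrM.
have : `|u.1| * `|z.1| <= A * B by rewrite ler_pM.
have : `|u.2| * `|z.2| <= A * B by rewrite ler_pM.
lra.
Qed.

Lemma axis_bound x : `|(axis x).1| <= 1 /\ `|(axis x).2| <= 1.
Proof. by case: x => -[] [] /=; rewrite ?normrN ?normr1 ?normr0 lexx ?ler01. Qed.

(** Let [g] be the matrix of [w] and [g'] its derivative. The
    hypothesis says that [v'] [g] = [g] [v] + [g']. Apply both sides to the axis
    of the last letter and take the expanding coordinate of the first letter,
    which is [p] for [g]. The left side is [O(|v'| |p|)] because the image lies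
    in a cone, the first term on the right is [O(|v| |p|)] by the same argument
    for the reversed word, and the last term is at least [size w / 2] times
    [|p|]. *)
Lemma displacement_bound w (X Y Z X' Y' Z' B B' : R) : reduced w ->
  (forall u, sl2_apply X' Y' Z' (word_mx w u) =
     addp (word_mx w (sl2_apply X Y Z u)) (word_der w u)) ->
  `|X| <= B -> `|Y| <= B -> `|Z| <= B ->
  `|X'| <= B' -> `|Y'| <= B' -> `|Z'| <= B' ->
  (size w)%:R <= 18 * (B + B').
Proof.
move=> rw eqw hX hY hZ hX' hY' hZ'.
have B0 : 0 <= B := le_trans (normr_ge0 _) hX.
have B'0 : 0 <= B' := le_trans (normr_ge0 _) hX'.
case: w rw eqw => [|x w] rw eqw; first by rewrite /=; lra.
have [r rn [cg hr _]] := word_growth rw.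
set y := last x w in hr cg; set g := word_mx _ _ in hr cg.
(* [h] is the row of the matrix of the word given by its first axis. *)
have := rev_reduced rw; have : rev (x :: w) = y :: rev (belast x w).
  by rewrite lastI rev_rcons.
move=> rE; rewrite rE => rrw.
have [r' _ [ch _ _]] := word_growth rrw; move: ch {r'}.
have -> : last y (rev (belast x w)) = x.
  by have := congr1 (last x) rE; rewrite rev_cons last_rcons.
set h := word_mx _ _ => ch.
have hE : expanding y h = expanding x g.
  by rewrite /expanding /h -rE -dotp_word dotpC.
have [g1 g2] := cone_bound cg; have [h1 h2] := cone_bound ch.
rewrite hE in h1 h2.
have := congr1 (expanding x) (eqw (axis y)); rewrite expanding_addp hr -/g => E.
have E1 : expanding x (word_mx (x :: w) (sl2_apply X Y Z (axis y))) =
    dotp h (sl2_apply X Y Z (axis y)).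
  by rewrite /h dotp_word -rE revK.
have [a1 a2] := axis_bound y; have [b1 b2] := axis_bound x.
have [c1 c2] := sl2_apply_bound hX hY hZ a1 a2.
have [d1 d2] := sl2_apply_bound hX' hY' hZ' g1 g2.
have := dotp_bound h1 h2 c1 c2; rewrite -E1 => F1.
have := dotp_bound b1 b2 d1 d2; rewrite -[dotp _ _]/(expanding x _) E => F2.
set p := expanding x g in E F1 F2 *.
have p0 : 0 < `|p| by rewrite normr_gt0; case: cg.
have F3 : `|r * p| <= 9 * (B + B') * `|p|.
  set m := expanding x _ in F1 F2.
  have := ler_normB (m + r * p) m; rewrite addrAC subrr add0r; lra.
have r0 : 0 <= r by apply: le_trans rn; rewrite mulr_ge0 // invr_ge0.
move: F3; rewrite normrM (ger0_norm r0) ler_pM2r //; lra.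
Qed.

End PingPong.

(** * Affine actions of free groups on the space of traceless matrices *)

Section WordAction.
Variable K : numFieldType.
Implicit Types (v : 'rV[K]_3) (x : letter) (w : seq letter).

Definition iX : 'I_3 := @Ordinal 3 0 isT.
Definition iY : 'I_3 := @Ordinal 3 1 isT.
Definition iZ : 'I_3 := @Ordinal 3 2 isT.

Lemma row3P (u v : 'rV[K]_3) :
  u 0 iX = v 0 iX -> u 0 iY = v 0 iY -> u 0 iZ = v 0 iZ -> u = v.
Proof.
move=> h0 h1 h2; apply/rowP => -[[|[|[|//]]] ij].
- by rewrite (_ : Ordinal _ = iX) //; apply: val_inj.
- by rewrite (_ : Ordinal _ = iY) //; apply: val_inj.
- by rewrite (_ : Ordinal _ = iZ) //; apply: val_inj.
Qed.

Definition row3 (a b c : K) : 'rV[K]_3 := \row_j [:: a; b; c]`_j.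

Lemma row3E a b c : (row3 a b c 0 iX = a) * (row3 a b c 0 iY = b) * (row3 a b c 0 iZ = c).
Proof. by rewrite !mxE. Qed.

Definition boost_cosh : K := (64 + 64^-1) / 2.
Definition boost_sinh (e : bool) : K := if e then (64 - 64^-1) / 2 else - ((64 - 64^-1) / 2).

(** Conjugation by [letter_mx], in the coordinates of [sl2_apply]. The
    hyperbolic sine and cosine are those of the logarithm of 64, as conjugation
    has the squares of 8 and 1/8 as eigenvalues. *)
Definition letter_lin x v : 'rV[K]_3 :=
  let s := boost_sinh x.2 in
  if x.1 then row3 (boost_cosh * v 0 iX + s * v 0 iY) (s * v 0 iX + boost_cosh * v 0 iY) (v 0 iZ)
  else row3 (v 0 iX) (boost_cosh * v 0 iY - s * v 0 iZ) (- s * v 0 iY + boost_cosh * v 0 iZ).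

(** The traceless matrix of [letter_gen], in the same coordinates. *)
Definition letter_shift x : 'rV[K]_3 :=
  let t := if x.2 then 1 else -1 in if x.1 then row3 0 0 t else row3 t 0 0.

Definition letter_act x v := letter_lin x v + letter_shift x.

Definition word_lin w v := foldr letter_lin v w.
Definition word_act w v := foldr letter_act v w.

Lemma boost_sinhN e : boost_sinh (~~ e) = - boost_sinh e.
Proof. by case: e; rewrite /= ?opprK. Qed.

Lemma letter_lin_linear x : linear (letter_lin x).
Proof.
move=> a u v; case: x => -[] e; apply: row3P;
  rewrite /letter_lin /= !(mxE, row3E) /=; ring.
Qed.

Lemma word_lin_linear w : linear (word_lin w).
Proof.
by elim: w => [|x w IH] a u v //=; rewrite IH letter_lin_linear.
Qed.

Lemma word_actD w u v : word_act w (u + v) = word_lin w u + word_act w v.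
Proof.
elim: w => [|x w IH] //=; rewrite IH /letter_act addrA.
by have := letter_lin_linear x 1 (word_lin w u) (word_act w v); rewrite !scale1r => ->.
Qed.

Lemma word_act_cat w w' v : word_act (w ++ w') v = word_act w (word_act w' v).
Proof. exact: foldr_cat. Qed.

Lemma letter_actK x v : letter_act x (letter_act (letter_inv x) v) = v.
Proof.
case: x => -[] e; rewrite /letter_act /letter_lin /letter_shift /= boost_sinhN;
  apply: row3P; rewrite !(row3E, mxE) /=; case: e => /=;
  rewrite /boost_cosh /boost_sinh /=; field; rewrite ?pnatr_eq0 //.
Qed.

End WordAction.

Section RealDisplacement.
Variable R : realFieldType.
Implicit Types (v : 'rV[R]_3) (w : seq letter).

Definition bounded_row (B : R) v := forall i, `|v 0 i| <= B.

Definition row_apply v u := sl2_apply (v 0 iX) (v 0 iY) (v 0 iZ) u.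

Lemma row_apply_letter x v u :
  row_apply (letter_act x v) (letter_mx x u) =
  addp (letter_mx x (row_apply v u)) (letter_gen x (letter_mx x u)).
Proof.
case: x => -[] [];
  rewrite /row_apply /letter_act /letter_lin /letter_shift /= /sl2_apply /addp /=
    !(row3E, mxE) /= /boost_cosh /boost_sinh;
  congr (_, _) => /=; field; rewrite ?pnatr_eq0 //.
Qed.

Lemma letter_mxD x (u u' : R * R) : letter_mx x (addp u u') = addp (letter_mx x u) (letter_mx x u').
Proof. by case: x => -[] []; rewrite /addp /=; congr (_, _); ring. Qed.

(** This is the relation [w g = g v + g'] between a matrix [v] and its
    image [w] by the word with matrix [g]. *)
Lemma row_apply_word w v u :
  row_apply (word_act w v) (word_mx w u) =
  addp (word_mx w (row_apply v u)) (word_der w u).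
Proof.
elim: w => [|x w IH] /=; first by rewrite /addp /= !addr0.
rewrite row_apply_letter IH letter_mxD /addp /=; congr (_, _); ring.
Qed.

Lemma word_act_displacement w v (B B' : R) : reduced w -> bounded_row B v ->
  bounded_row B' (word_act w v) -> (size w)%:R <= 18 * (B + B').
Proof.
move=> rw bv bv'; apply: displacement_bound rw (row_apply_word w v) _ _ _ _ _ _;
  [exact: bv|exact: bv|exact: bv|exact: bv'|exact: bv'|exact: bv'].
Qed.

Lemma row_bounded v : exists B, bounded_row B v.
Proof.
exists (`|v 0 iX| + `|v 0 iY| + `|v 0 iZ|) => i.
have [a0 a1 a2] : [/\ 0 <= `|v 0 iX|, 0 <= `|v 0 iY| & 0 <= `|v 0 iZ|] by split; exact: normr_ge0.
case: i => -[|[|[|//]]] p.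
- by rewrite (_ : Ordinal p = iX); [lra|exact/val_inj].
- by rewrite (_ : Ordinal p = iY); [lra|exact/val_inj].
- by rewrite (_ : Ordinal p = iZ); [lra|exact/val_inj].
Qed.

End RealDisplacement.

Definition word_pow n (w : seq letter) := flatten (nseq n w).

Lemma reduced_pow x w n : reduced (x :: w) -> noncancelling (last x w) x ->
  reduced (word_pow n (x :: w)).
Proof.
move=> rw wx; suff : path noncancelling (last x w) (word_pow n (x :: w)) by move=> /path_sorted.
elim: n => //= n IH; rewrite wx cat_path.
by apply/andP; split => //; apply/andP; split; [exact: rw|exact: IH].
Qed.

Lemma size_word_pow n w : size (word_pow n w) = (n * size w)%N.
Proof. by elim: n => //= n IH; rewrite size_cat IH mulSn. Qed.

(** After conjugation the word may be taken cyclically reduced.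
    Its powers are then reduced, and if it had a fixed point they would all
    fix it, against [word_act_displacement], which bounds their lengths. *)
Lemma word_act_free (R : archiRealFieldType) w (v : 'rV[R]_3) : reduced w -> w != [::] ->
  word_act w v != v.
Proof.
move: v; have [n] := ubnP (size w); elim: n w => // n IH w wn v rw w0.
case: w wn rw w0 => // x w wn rw _; apply/eqP => fix_v.
have [wx|] := boolP (noncancelling (last x w) x).
  have fix_pow m : word_act (word_pow m (x :: w)) v = v.
    elim: m => // m IHm.
    by rewrite -[word_pow _ _]/((x :: w) ++ word_pow m (x :: w)) word_act_cat IHm.
  have [B bv] := row_bounded v.
  have B0 : 0 <= B := le_trans (normr_ge0 _) (bv iX).
  have [m Bm] : exists m : nat, 18 * (B + B) < m%:R.
    by exists (Num.bound (18 * (B + B))); apply: archi_boundP; lra.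
  have /= := word_act_displacement (reduced_pow m rw wx) bv.
  rewrite fix_pow => /(_ _ bv); rewrite size_word_pow => h.
  have : (m <= m * size (x :: w))%N by rewrite leq_pmulr.
  rewrite -(ler_nat R) => h'.
  by have := lt_le_trans Bm (le_trans h' h); rewrite ltxx.
case: (lastP w) wn rw fix_v => [|w' y] wn rw fix_v.
  by rewrite /noncancelling /letter_inv /= negbK; case: x {wn rw fix_v} => [[] []].
rewrite last_rcons /noncancelling negbK => /eqP xE.
case: w' wn rw fix_v => [|z w'] wn rw fix_v.
  move: rw; rewrite /reduced /= andbT /noncancelling xE /letter_inv /= negbK.
  by case: (y) => a b /=; rewrite eqxx.
have rz : reduced (z :: w').
  move: rw; rewrite /reduced /= => /andP[_]; rewrite rcons_path => /andP[] //.
have sz : (size (z :: w') < n)%N by move: wn; rewrite /= size_rcons => /ltnW.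
have /eqP[] := IH _ sz (letter_act y v) rz isT.
rewrite -{2}fix_v -rcons_cons -cats1 -cat1s !word_act_cat xE /=.
by rewrite letter_actK.
Qed.

Section FreeGroupAction.
Variables (X : choiceType) (idx : X -> nat).
Hypothesis idx_inj : injective idx.

(** The conjugates [b^i a b^-i] generate a free subgroup of the free group
    on [a] and [b]. *)
Definition expand (p : X * bool) : seq letter :=
  nseq (idx p.1) (true, true) ++ (false, p.2) :: nseq (idx p.1) (true, false).

Definition expand_word (w : word X) : seq letter := flatten [seq expand p | p <- w].

Lemma expand_word_cat w w' : expand_word (w ++ w') = expand_word w ++ expand_word w'.
Proof. by rewrite /expand_word map_cat flatten_cat. Qed.

Definition reduced_in_X : word X -> bool := sorted (fun p q => q != (p.1, ~~ p.2)).

Definition push (p : X * bool) (w : word X) : word X :=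
  if w is q :: w' then if q == (p.1, ~~ p.2) then w' else p :: w else [:: p].

Lemma push_reduced p w : reduced_in_X w -> reduced_in_X (push p w).
Proof.
case: w => //= q w h; case: ifPn => [_|qp] /=; last by rewrite qp.
exact: path_sorted h.
Qed.

Lemma push_eq p w : word_eq (p :: w) (push p w).
Proof.
case: w => [|q w] /=; first exact: word_eq_refl.
case: ifPn => [/eqP ->|_]; last exact: word_eq_refl.
by case: p => a b; exact: (word_eq_cancel [::] w a b).
Qed.

Lemma reduced_representative w : exists2 w', reduced_in_X w' & word_eq w w'.
Proof.
elim: w => [|p w [w' rw' ww']]; first by exists [::] => //; exact: word_eq_refl.
exists (push p w'); first exact: push_reduced.
apply: word_eq_trans (push_eq p w'); exact: (word_eq_catl [:: p] ww').
Qed.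

Lemma word_act_nseqK (K : numFieldType) n x (v : 'rV[K]_3) :
  word_act (nseq n x) (word_act (nseq n (letter_inv x)) v) = v.
Proof.
elim: n v => // n IH v.
rewrite -[in nseq n.+1 (letter_inv x)]addn1 nseqD word_act_cat /= IH.
exact: letter_actK.
Qed.

Lemma word_act_nseq_sub (K : numFieldType) i j (v : 'rV[K]_3) :
  word_act (nseq i (true, false)) (word_act (nseq j (true, true)) v) =
  word_act (nseq (i - j) (true, false) ++ nseq (j - i) (true, true)) v.
Proof.
have [ij|/ltnW ij] := leqP i j.
  rewrite (eqP (_ : (i - j == 0)%N)) ?subn_eq0 //=.
  rewrite -{1}(subnKC ij) nseqD word_act_cat.
  exact: (word_act_nseqK i (true, false)).
rewrite (eqP (_ : (j - i == 0)%N)) ?subn_eq0 //= cats0.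
rewrite -{1}(subnK ij) nseqD word_act_cat.
by rewrite (word_act_nseqK j (true, false)).
Qed.

Lemma expand_cancel (K : numFieldType) a b (v : 'rV[K]_3) :
  word_act (expand (a, b)) (word_act (expand (a, ~~ b)) v) = v.
Proof.
rewrite /expand /= !word_act_cat /= !word_act_nseqK.
have /= -> := @letter_actK K (false, b).
by rewrite (word_act_nseqK _ (true, true)).
Qed.

Lemma expand_word_eq (K : numFieldType) w w' : word_eq w w' ->
  forall v : 'rV[K]_3, word_act (expand_word w) v = word_act (expand_word w') v.
Proof.
elim=> [//|u u' _ IH v|u u' u'' _ IH _ IH' v|u u' a b v].
- by rewrite IH.
- by rewrite IH IH'.
have -> : expand_word (u ++ [:: (a, b); (a, ~~ b)] ++ u') =
    expand_word u ++ (expand (a, b) ++ expand (a, ~~ b)) ++ expand_word u'.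
  by rewrite expand_word_cat -catA; congr (_ ++ _).
rewrite expand_word_cat [LHS]word_act_cat [RHS]word_act_cat; congr word_act.
by rewrite [LHS]word_act_cat [LHS]word_act_cat expand_cancel.
Qed.

Lemma reduced_nseq_cat (e : bool) n f (w : seq letter) :
  path noncancelling (false, f) w ->
  reduced (nseq n (true, e) ++ (false, f) :: w).
Proof.
case: n => // n h /=; elim: n => [|n IH] /=; first by rewrite h.
by rewrite IH andbT; case: e {IH}.
Qed.

Lemma path_nseq_cat (e e' : bool) n f (w : seq letter) : (n > 0)%N ->
  path noncancelling (false, f) w ->
  path noncancelling (false, e') (nseq n (true, e) ++ (false, f) :: w).
Proof.
case: n => // n _ h /=; rewrite /noncancelling /= -/noncancelling.
exact: (reduced_nseq_cat e n.+1 h).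
Qed.

(** Between the letters [a] of two consecutive generators there
    remains a power of [b] whose exponent is the difference of their indices.
    If it is zero then both generators are equal, and they carry the same sign
    because the word is reduced; so no letter [a] ever cancels. *)
Lemma expand_reduced (w : word X) : reduced_in_X w -> w != [::] ->
  exists s, [/\ reduced s, s != [::] & forall (K : numFieldType) (v : 'rV[K]_3),
    word_act (expand_word w) v = word_act s v].
Proof.
suff H p w' : path (fun p q => q != (p.1, ~~ p.2)) p w' ->
    exists s, path noncancelling (false, p.2) s /\
     forall (K : numFieldType) (v : 'rV[K]_3), word_act (expand_word (p :: w')) v =
      word_act (nseq (idx p.1) (true, true) ++ (false, p.2) :: s) v.
  case: w => // p w rw _; have [s [rs sE]] := H _ _ rw.
  exists (nseq (idx p.1) (true, true) ++ (false, p.2) :: s); split => //.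
    exact: reduced_nseq_cat.
  by case: (idx p.1).
elim: w' p => [|q w' IH] p.
  move=> _; exists (nseq (idx p.1) (true, false)); split.
    case: (idx p.1) => //= n; rewrite /noncancelling /=.
    by elim: n => //= n ->.
  by move=> K v; rewrite /expand_word /= cats0.
move=> /= /andP[pq /IH [s [rs sE]]].
exists (nseq (idx p.1 - idx q.1) (true, false) ++ nseq (idx q.1 - idx p.1) (true, true)
    ++ (false, q.2) :: s); split.
  have [ij|ij|/idx_inj ij] := ltngtP (idx p.1) (idx q.1).
  - rewrite (eqP (_ : (idx p.1 - idx q.1 == 0)%N)) ?subn_eq0 1?ltnW //=.
    by apply: path_nseq_cat => //; rewrite subn_gt0.
  - rewrite (eqP (_ : (idx q.1 - idx p.1 == 0)%N)) ?subn_eq0 1?ltnW //=.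
    by apply: path_nseq_cat => //; rewrite subn_gt0.
  - rewrite ij subnn /= rs andbT.
    move: pq; case: (p) (q) ij => a b [a' b'] /= ->.
    by case: b b' => [] [] //; rewrite eqxx.
move=> K v.
have -> : expand_word [:: p, q & w'] = expand p ++ expand_word (q :: w') by [].
rewrite word_act_cat sE /expand !word_act_cat /=.
by rewrite word_act_nseq_sub catA [in RHS]word_act_cat.
Qed.

End FreeGroupAction.

Section ComplexFreeGroupAction.
Variables (R : realType) (X : choiceType) (idx : X -> nat).
Hypothesis idx_inj : injective idx.
Local Notation C := R[i].
Implicit Types (v : 'rV[C]_3) (g : free_group X).

Definition re_row v : 'rV[R]_3 := \row_j complex.Re (v 0 j).

Lemma Re_D (a b : C) : complex.Re (a + b) = complex.Re a + complex.Re b.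
Proof. by case: a b => ? ? []. Qed.

Lemma Re_N (a : C) : complex.Re (- a) = - complex.Re a.
Proof. by case: a. Qed.

Lemma Re_Ml (a : R) (b : C) : complex.Re (a%:C * b) = a * complex.Re b.
Proof. by case: b => x y /=; rewrite mul0r subr0. Qed.

Lemma re_letter_act x v : re_row (letter_act x v) = letter_act x (re_row v).
Proof.
have chE : boost_cosh C = (boost_cosh R)%:C.
  by rewrite /boost_cosh rmorphM fmorphV rmorphD fmorphV !rmorph_nat.
have shE e : boost_sinh C e = (boost_sinh R e)%:C.
  by rewrite /boost_sinh; case: e; rewrite ?rmorphN rmorphM fmorphV rmorphB fmorphV !rmorph_nat.
case: x => -[] e; apply: row3P;
  rewrite /letter_act /letter_lin /letter_shift /= !(mxE, row3E) /= ?chE ?shE ?mulNr;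
  rewrite ?(Re_D, Re_N, Re_Ml, rmorphN) //; case: e => //=; rewrite ?oppr0 //.
Qed.

Lemma re_word_act w v : re_row (word_act w v) = word_act w (re_row v).
Proof. by elim: w => [|x w IH] //=; rewrite re_letter_act IH. Qed.

Definition free_act g v := word_act (expand_word idx (repr g)) v.
Definition free_lin g v := word_lin (expand_word idx (repr g)) v.

Lemma free_act_class (w : word X) v :
  free_act (free_group_class w) v = word_act (expand_word idx w) v.
Proof.
by apply: expand_word_eq; apply/free_group_classP; rewrite free_group_class_repr.
Qed.

Lemma free_act1 v : free_act 1%g v = v.
Proof. exact: (free_act_class [::]). Qed.

Lemma free_actM g h v : free_act (g * h)%g v = free_act g (free_act h v).
Proof.
rewrite -(free_group_class_repr g) -(free_group_class_repr h).
have -> : (free_group_class (repr g) * free_group_class (repr h))%g =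
   free_group_class (repr g ++ repr h) by exact: free_group_mul_class.
by rewrite !free_act_class expand_word_cat word_act_cat.
Qed.

Lemma free_actD g u v : free_act g (u + v) = free_lin g u + free_act g v.
Proof. exact: word_actD. Qed.

Lemma free_lin_linear g : linear (free_lin g).
Proof. exact: word_lin_linear. Qed.

Lemma free_act_reduced g : exists s, [/\ reduced s, g <> 1%g -> s != [::] &
  forall v, free_act g v = word_act s v].
Proof.
have [w rw ww] := reduced_representative (repr g).
have gE : g = free_group_class w.
  by rewrite -(free_group_class_repr g); apply/free_group_classP.
have [w0|w0] := eqVneq w [::].
  exists [::]; split => // [|v]; first by rewrite gE w0.
  by rewrite gE w0 free_act_class.
have [s [rs s0 sE]] := expand_reduced idx_inj rw w0.
by exists s; split => // v; rewrite gE free_act_class sE.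
Qed.

Lemma free_act_free g v : free_act g v = v -> g = 1%g.
Proof.
have [s [rs s0 sE]] := free_act_reduced g; rewrite sE => fix_v.
apply: contrapT => /s0 /(word_act_free (re_row v) rs).
by rewrite -re_word_act fix_v eqxx.
Qed.

Lemma finite_bounded_words n : finite_set [set s : seq letter | (size s <= n)%N].
Proof.
apply: (@sub_finite_set _ _ (\bigcup_(k in `I_n.+1) range (@tval k letter))).
  by move=> s /= sn; exists (size s) => //; exists (in_tuple s).
apply: bigcup_finite => [|k _]; first exact: finite_II.
exact/finite_image/finite_finset.
Qed.

(** The reduced words that move some point with bounded real part to
    another one have bounded length, and distinct elements are given by
    distinct words since the action is free. *)
Lemma free_act_finite (B : R) : finite_set [set g | exists v,
  bounded_row B (re_row v) /\ bounded_row B (re_row (free_act g v))].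
Proof.
have [f fP] : exists f : free_group X -> seq letter, forall g,
    [/\ reduced (f g), g <> 1%g -> f g != [::] & forall v, free_act g v = word_act (f g) v].
  exists (fun g => sval (cid (free_act_reduced g))) => g; exact: (svalP (cid (free_act_reduced g))).
have f_inj : injective f.
  move=> g h fgh; have E : free_act g 0 = free_act h 0.
    by have [_ _ ->] := fP g; have [_ _ ->] := fP h; rewrite fgh.
  have : free_act (h^-1 * g)%g 0 = 0 by rewrite free_actM E -free_actM mulVg free_act1.
  by move/free_act_free/(congr1 (fun k => h * k)%g); rewrite mulVKg mulg1.
have [n Bn] : exists n : nat, 18 * (B + B) < n%:R.
  have [B0|B0] := leP 0 (18 * (B + B)).
    by exists (Num.bound (18 * (B + B))); apply: archi_boundP.
  by exists 0%N.
apply: (@sub_finite_set _ _ (f @^-1` [set s : seq letter | (size s <= n)%N])).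
  move=> g [v [bv bgv]] /=; have [rg _ gE] := fP g.
  rewrite gE re_word_act in bgv.
  have := word_act_displacement rg bv bgv.
  by move=> /le_lt_trans /(_ Bn); rewrite ltr_nat => /ltnW.
by apply: finite_preimage (finite_bounded_words n) => x y _ _; exact: f_inj.
Qed.

End ComplexFreeGroupAction.

(** * Lifting homotopies through a covering map *)

(** A form of real induction: a property that holds at 0 and
    that passes, near every point of the interval, from each value to the
    larger ones, holds on the whole interval. The proof looks at the supremum
    of the values at which it holds. *)
Lemma interval_propagation (R : realType) (P : R -> Prop) : P 0 ->
  (forall s, 0 <= s <= 1 -> exists2 e, 0 < e & forall u v, 0 <= u -> u <= v -> v <= 1 ->
     `|u - s| < e -> `|v - s| < e -> P u -> P v) ->
  forall s, 0 <= s <= 1 -> P s.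
Proof.
move=> P0 loc s /andP[s0 s1].
pose A := [set u : R | [/\ 0 <= u, u <= s & P u]].
have A0 : A 0 by split.
have supA : has_sup A by split; [exists 0 | exists s => u [] ].
have m0 : 0 <= sup A by exact: ub_le_sup supA.2 _ A0.
have ms : sup A <= s by apply: ge_sup; [exists 0 | move=> u []].
have [|e e0 he] := loc (sup A); first by rewrite m0 (le_trans ms).
have [u [u0 us Pu] ue] := sup_adherent e0 supA.
have um : u <= sup A by exact: ub_le_sup supA.2 _ _.
pose v := Num.min s (sup A + e / 2).
have e2 : 0 < e / 2 by rewrite divr_gt0.
have mv : sup A <= v by rewrite /v le_min ms /=; lra.
have vle : v <= sup A + e / 2 by rewrite /v ge_min lexx orbT.
have vs : v <= s by rewrite /v ge_min lexx.
have Pv : P v.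
  apply: (he u) => //; [lra|lra| |]; rewrite ltr_norml; lra.
have vm : v <= sup A by apply: ub_le_sup supA.2 _ _; split => //; lra.
have [vE|vE] : v = s \/ v = sup A + e / 2.
    by rewrite /v; case: leP => _; [left|right].
  by rewrite -vE.
by lra.
Qed.

Lemma continuous_maxf (R : realType) (T : topologicalType) (a b : T -> R) :
  continuous a -> continuous b -> continuous (fun p => Num.max (a p) (b p)).
Proof. by move=> ca cb p; apply: continuous_max; [exact: ca|exact: cb]. Qed.

Lemma continuous_minf (R : realType) (T : topologicalType) (a b : T -> R) :
  continuous a -> continuous b -> continuous (fun p => Num.min (a p) (b p)).
Proof. by move=> ca cb p; apply: continuous_min; [exact: ca|exact: cb]. Qed.

Lemma open_prod (T U : topologicalType) (A : set T) (B : set U) :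
  open A -> open B -> open (A `*` B).
Proof.
move=> oA oB; rewrite openE => -[x y] [/= Ax By].
by exists (A, B) => //=; split; exact: open_nbhs_nbhs.
Qed.

Section Lifting.
Variables (R : realType) (E B : topologicalType) (p : E -> B).
Hypothesis hausE : hausdorff_space E.
Hypothesis p_inj : forall e, exists2 W, open_nbhs e W &
  forall x y, W x -> W y -> p x = p y -> x = y.
Hypothesis p_section : forall b, exists2 U, open_nbhs b U &
  forall e, U (p e) -> exists2 sec : B -> E, sec (p e) = e &
    forall b', U b' -> {for b', continuous sec} /\ p (sec b') = b'.

(** Near a point where the two lifts agree, local injectivity keeps
    them equal; near a point where they differ, they differ on a neighbourhood
    since the space is Hausdorff, and there is nothing to propagate. *)
Lemma unique_lift (F G : R -> E) : continuous F -> continuous G -> F 0 = G 0 ->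
  (forall s, 0 <= s <= 1 -> p (F s) = p (G s)) -> forall s, 0 <= s <= 1 -> F s = G s.
Proof.
move=> cF cG FG0 pFG; apply: interval_propagation FG0 _ => s s01.
have nearE (A : set R) : nbhs s A -> exists2 e, 0 < e & forall u, `|u - s| < e -> A u.
  move=> /nbhs_ballP[e /= e0 he]; exists e => // u us; apply: he.
  by rewrite /ball /= distrC.
have [FGs|/eqP FGs] := pselect (F s = G s).
  have [W Ws Winj] := p_inj (F s).
  have W1 : nbhs (F s) W by exact: open_nbhs_nbhs.
  have W2 : nbhs (G s) W by rewrite -FGs.
  have F1 : \forall u \near s, W (F u) := cF s _ W1.
  have G1 : \forall u \near s, W (G u) := cG s _ W2.
  have [e e0 he] := nearE _ (filterI F1 G1).
  exists e => // u v u0 uv v1 _ /he[/= Fv Gv] _.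
  by apply: Winj => //; apply: pFG; lra.
have : exists AB : set E * set E, (F s \in AB.1 /\ G s \in AB.2) /\
    [/\ open AB.1, open AB.2 & AB.1 `&` AB.2 == set0].
  move: hausE; rewrite open_hausdorff => /(_ _ _ FGs)[AB [? ?] ?].
  by exists AB.
move=> [[A A'] [[/set_mem /= FA /set_mem /= GA] [oA oA' /eqP AA']]].
have F1 : \forall u \near s, A (F u) := cF s _ (open_nbhs_nbhs (conj oA FA)).
have G1 : \forall u \near s, A' (G u) := cG s _ (open_nbhs_nbhs (conj oA' GA)).
have [e e0 he] := nearE _ (filterI F1 G1).
exists e => // u v u0 uv v1 /he[/= Fu Gu] _ FGu.
have : (A `&` A') (F u) by split => //; rewrite FGu.
by rewrite AA'.
Qed.

(** Retraction of the line onto the unit interval. It turns maps that are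
    continuous on a cube only into maps continuous everywhere. *)
Definition clamp (s : R) : R := Num.max 0 (Num.min 1 s).

Lemma clamp01 s : 0 <= clamp s <= 1.
Proof.
by rewrite /clamp le_max lexx /= ge_max ler01 /= ge_min lexx.
Qed.

Lemma clamp_id s : 0 <= s <= 1 -> clamp s = s.
Proof. by move=> /andP[s0 s1]; rewrite /clamp min_r // max_r. Qed.

Lemma clamp_continuous : continuous clamp.
Proof.
apply: continuous_maxf; first exact: continuous_cstf.
by apply: continuous_minf; [exact: continuous_cstf|exact: continuous_idf].
Qed.

Section HomotopyLifting.
Variables (T : topologicalType) (H : T * R -> B) (F0 : T -> E).
Hypotheses (cH : continuous H) (cF0 : continuous F0).
Hypothesis (pF0 : forall t, p (F0 t) = H (t, 0)).

(** A lift of the homotopy over [N * [0, s0]] for a neighbourhood [N] of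
    [t0]. The lift is continuous for all values of the parameter, but it is
    only required to lie over the homotopy up to [s0]. *)
Definition lift_upto (t0 : T) (s0 : R) (NG : set T * (T * R -> E)) :=
  [/\ open_nbhs t0 NG.1,
     forall t s, NG.1 t -> {for (t, s), continuous NG.2},
     forall t, NG.1 t -> NG.2 (t, 0) = F0 t
   & forall t s, NG.1 t -> 0 <= s <= s0 -> p (NG.2 (t, s)) = H (t, s)].

Lemma slice_continuous (S : topologicalType) (G : T * R -> S) t s :
  {for (t, s), continuous G} -> {for t, continuous (fun t => G (t, s))}.
Proof.
move=> cG; apply: (@continuous_comp _ _ _ (fun t => (t, s)) G t) => //.
exact: (continuous_pair (@continuous_idf T) (@cst_continuous _ _ s)).
Qed.

Lemma line_continuous (S : topologicalType) (G : T * R -> S) t s :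
  {for (t, s), continuous G} -> {for s, continuous (fun s => G (t, s))}.
Proof.
move=> cG; apply: (@continuous_comp _ _ _ (fun s => (t, s)) G s) => //.
exact: (continuous_pair (@cst_continuous _ _ t) (@continuous_idf R)).
Qed.

(** Near [(t0, s)] the homotopy stays in an evenly covered open set.
    Continue the lift by the section through its value at [(t0, u)]; by local
    injectivity the two pieces agree at the parameter [u] for all [t] close to
    [t0]. *)
Lemma extend_lift t0 s : 0 <= s <= 1 -> exists2 e, 0 < e &
  forall u v, 0 <= u -> u <= v -> v <= 1 -> `|u - s| < e -> `|v - s| < e ->
    (exists NG, lift_upto t0 u NG) -> exists NG, lift_upto t0 v NG.
Proof.
move=> s01; have [U [oU Us] secU] := p_section (H (t0, s)).
have [[N1 N2] /= [N1t N2s] NU] := cH (open_nbhs_nbhs (conj oU Us)).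
have [e /= e0 he] := (nbhs_ballP _ _).1 N2s.
exists e => // u v u0 uv v1 us vs [[N G] [/= [oN Nt] cG G0 pG]].
have HU t r : N1 t -> u <= r <= v -> U (H (t, r)).
  move=> tN rI; apply: (NU (t, r)); split => //=; apply: he.
  move: us vs; rewrite /ball /= distrC !ltr_norml; lra.
have pGu : p (G (t0, u)) = H (t0, u) by apply: pG => //; lra.
have [|sec sec0 secP] := secU (G (t0, u)).
  by rewrite pGu; apply: HU; [exact: nbhs_singleton|lra].
rewrite pGu in sec0.
have [W [oW Wu] Winj] := p_inj (G (t0, u)).
have nW1 : \forall t \near t0, W (G (t, u)).
  exact: slice_continuous (cG t0 u Nt) _ (open_nbhs_nbhs (conj oW Wu)).
have nW2 : \forall t \near t0, W (sec (H (t, u))).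
  have HUt0 : U (H (t0, u)) by apply: HU; [exact: nbhs_singleton|lra].
  have cs : {for t0, continuous (sec \o (fun t => H (t, u)))}.
    apply: continuous_comp; first exact: slice_continuous (@cH (t0, u)).
    exact: (secP _ HUt0).1.
  by apply: cs; rewrite /= sec0; exact: open_nbhs_nbhs.
have : nbhs t0 (N `&` N1 `&` ([set t | W (G (t, u))] `&` [set t | W (sec (H (t, u)))])).
  by do 2!apply: filterI => //; exact: open_nbhs_nbhs.
rewrite nbhsE => -[N' N't0 N'P].
(* After [v] the homotopy may leave [U], where the section is continuous, so it
   is stopped at [v]. *)
pose h (tr : T * R) := H (tr.1, Num.min tr.2 v).
have ch : continuous h.
  move=> tr; apply: (@continuous_comp _ _ _ (fun tr : T * R => (tr.1, Num.min tr.2 v)) H tr).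
    apply: (@continuous_pair _ _ _ fst (fun tr : T * R => Num.min tr.2 v)) => q.
      exact: cvg_fst.
    apply: continuous_minf; last exact: continuous_cstf.
    by move=> ?; exact: cvg_snd.
  exact: cH.
exists (N', fun tr => if tr.2 <= u then G tr else sec (h tr)); split => //=.
- have cW : {within N' `*` [set: R],
      continuous (fun tr : T * R => if tr.2 <= u then G tr else sec (h tr))}.
    apply: (@continuous_within_if R _ _ (N' `*` [set: R]) snd u G (sec \o h)).
    + by move=> ?; exact: cvg_snd.
    + apply: continuous_in_subspaceT => -[t r] /set_mem[[/= N't _] _].
      by apply: cG; have [[]] := N'P _ N't.
    + apply: continuous_in_subspaceT => -[t r] /set_mem[[/= N't _] ur].
      apply: continuous_comp; first exact: ch.
      have [[_ N1t' ] _] := N'P _ N't.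
      have hU : U (h (t, r)) by apply: HU => //=; rewrite le_min ge_min lexx orbT uv ur.
      exact: (secP _ hU).1.
    + move=> [t r] [/= N't _] ->; rewrite /h /= min_l //.
      have [[Nt' N1t'] [Wt1 Wt2]] := N'P _ N't.
      have hU : U (H (t, u)) by apply: HU => //; lra.
      by apply: Winj => //; rewrite (secP _ hU).2 pG //; lra.
  have oN' : open (N' `*` [set: R]) by apply: open_prod; [exact: N't0.1|exact: openT].
  move=> t r N't.
  move: cW; rewrite continuous_open_subspace //; apply.
  by apply/mem_set; split.
- by move=> t N't; rewrite u0 G0 //; have [[]] := N'P _ N't.
- move=> t r N't rI; have [[Nt' N1t'] _] := N'P _ N't.
  case: leP => ru; first by rewrite pG //; lra.
  have hU : U (h (t, r)) by apply: HU => //=; rewrite min_l; lra.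
  by rewrite (secP _ hU).2 /h /= min_l //; lra.
Qed.

Lemma local_lift t0 : exists NG, lift_upto t0 1 NG.
Proof.
apply: (@interval_propagation R (fun s => exists NG, lift_upto t0 s NG));
  last by rewrite ler01 lexx.
  exists (setT, F0 \o fst); split => //=.
  - by split => //; exact: openT.
  - move=> t s _; apply: continuous_comp; [exact: cvg_fst|exact: cF0].
  - by move=> t s _ s0; rewrite pF0; congr (H (t, _)); lra.
exact: extend_lift.
Qed.

(** Local lifts exist by [interval_propagation]. They agree where
    two of them are defined, by unique lifting along each line, so they glue to
    a continuous map. *)
Lemma homotopy_lifting : exists F : T * R -> E, [/\ continuous F,
  forall t, F (t, 0) = F0 t & forall t s, 0 <= s <= 1 -> p (F (t, s)) = H (t, s)].
Proof.
have [NG NGP] : exists NG : T -> set T * (T * R -> E), forall t, lift_upto t 1 (NG t).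
  exists (fun t => sval (cid (local_lift t))) => t; exact: (svalP (cid (local_lift t))).
have agree t0 t s : (NG t0).1 t -> (NG t).2 (t, clamp s) = (NG t0).2 (t, clamp s).
  move=> Nt; have [[oN Ntt] cG G0 pG] := NGP t.
  have [_ cG' G0' pG'] := NGP t0.
  apply: (@unique_lift (fun s => (NG t).2 (t, s)) (fun s => (NG t0).2 (t, s))).
  - by move=> r; apply: line_continuous; exact: cG.
  - by move=> r; apply: line_continuous; exact: cG'.
  - by rewrite G0 // G0'.
  - by move=> r r01; rewrite pG // pG'.
  - exact: clamp01.
exists (fun ts => (NG ts.1).2 (ts.1, clamp ts.2)); split => /=.
- move=> [t0 s]; have [Nt0 cG _ _] := NGP t0.
  have cc : {for (t0, s), continuous (fun ts : T * R => (NG t0).2 (ts.1, clamp ts.2))}.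
    apply: (@continuous_comp _ _ _ (fun ts : T * R => (ts.1, clamp ts.2)) (NG t0).2).
      apply: (@continuous_pair _ _ _ fst (fun tr : T * R => clamp tr.2)) => q; first exact: cvg_fst.
      by apply: (@continuous_comp _ _ _ snd clamp); [exact: cvg_snd|exact: clamp_continuous].
    by apply: cG; case: Nt0.
  move=> A hA; have hA' := cc A hA.
  have hN : \forall ts \near (t0, s), (NG t0).1 ts.1.
    have : nbhs t0 (NG t0).1 by exact: open_nbhs_nbhs.
    exact: (@cvg_fst _ _ (nbhs t0) (nbhs s) _).
  by apply: filterS2 hN hA' => -[t r] /= Nt; rewrite (agree t0).
- move=> t; have [[oN Ntt] _ G0 _] := NGP t.
  by rewrite clamp_id ?lexx ?ler01 // G0.
- move=> t s s01; have [[oN Ntt] _ _ pG] := NGP t.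
  by rewrite clamp_id // pG.
Qed.

End HomotopyLifting.

(** Lift the contraction [(t, s) |-> f (s t)], which starts from a
    constant map. *)
Lemma cone_lifting n (f : 'rV[R]_n -> B) e0 : continuous f -> p e0 = f 0 ->
  exists F : 'rV[R]_n -> E, [/\ continuous F, F 0 = e0 & forall t, p (F t) = f t].
Proof.
move=> cf pe0.
have cH : continuous (fun ts : 'rV[R]_n * R => f (ts.2 *: ts.1)).
  move=> ts; apply: (@continuous_comp _ _ _ (fun ts : 'rV[R]_n * R => ts.2 *: ts.1) f);
    last exact: cf.
  by apply: cvgZ; [exact: cvg_snd|exact: cvg_fst].
have pH (t : 'rV[R]_n) : p e0 = f ((t, 0 : R).2 *: (t, 0 : R).1) by rewrite /= scale0r.
have [F [cF F0 pF]] := homotopy_lifting cH (@cst_continuous _ _ e0) pH.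
exists (fun t => F (t, 1)); split.
- by move=> t; apply: slice_continuous; exact: cF.
- rewrite -[RHS](F0 0); symmetry.
  apply: (@unique_lift (fun=> F (0, 0)) (fun s => F (0, s))) => //.
  + by move=> ?; exact: cvg_cst.
  + by move=> s; apply: line_continuous; exact: cF.
  + by move=> s s01; rewrite F0 pF //= scaler0 pe0.
  + by rewrite ler01 lexx.
- by move=> t; rewrite pF /= ?scale1r // ler01 lexx.
Qed.

End Lifting.

(** * Homotopy groups of a quotient by a free action *)

Lemma continuous_mx (T U : topologicalType) m n (f : T -> 'M[U]_(m, n)) x :
  (forall i j, {for x, continuous (fun t => f t i j)}) -> {for x, continuous f}.
Proof.
move=> cf A [P hP sPA].
have : \forall t \near x, forall i j, P i j (f t i j).
  by apply: filter_forall => i; apply: filter_forall => j; apply: cf; exact: hP.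
by apply: filterS => t Pt; exact: sPA.
Qed.

Section HomotopyGroupsOfQuotient.
Variables (R : realType) (E B : topologicalType) (p : E -> B).
Hypothesis hausE : hausdorff_space E.
Hypothesis p_cont : continuous p.
Hypothesis p_inj : forall e, exists2 W, open_nbhs e W &
  forall x y, W x -> W y -> p x = p y -> x = y.
Hypothesis p_section : forall b, exists2 U, open_nbhs b U &
  forall e, U (p e) -> exists2 sec : B -> E, sec (p e) = e &
    forall b', U b' -> {for b', continuous sec} /\ p (sec b') = b'.
Variables (G : groupType) (act : G -> E -> E).
Hypothesis act1 : forall e, act 1%g e = e.
Hypothesis actM : forall g h e, act (g * h)%g e = act g (act h e).
Hypothesis act_cont : forall g, continuous (act g).
Hypothesis act_free : forall g e, act g e = e -> g = 1%g.
Hypothesis p_act : forall g e, p (act g e) = p e.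
Hypothesis p_fibre : forall e e', p e = p e' -> exists g, act g e = e'.
Hypothesis p_surj : forall b, exists e, p e = b.
Variable seg : E * E * R -> E.
Hypothesis seg_cont : continuous seg.
Hypothesis seg0 : forall u v, seg (u, v, 0) = u.
Hypothesis seg1 : forall u v, seg (u, v, 1) = v.
Hypothesis seg_diag : forall u s, seg (u, u, s) = u.

Lemma act_inj g h e : act g e = act h e -> g = h.
Proof.
move=> gh; have : act (h^-1 * g)%g e = e by rewrite actM gh -actM mulVg act1.
by move/act_free/(congr1 (fun k => h * k)%g); rewrite mulVKg mulg1.
Qed.

Definition cube_clamp n (t : 'rV[R]_n) : 'rV[R]_n := \row_i clamp (t 0 i).

Lemma cube_clamp_cube n (t : 'rV[R]_n) : cube (cube_clamp t).
Proof. by move=> i; rewrite mxE clamp01. Qed.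

Lemma cube_clamp_id n (t : 'rV[R]_n) : cube t -> cube_clamp t = t.
Proof. by move=> ct; apply/rowP => i; rewrite mxE clamp_id. Qed.

Lemma cube_clamp_continuous n : continuous (@cube_clamp n).
Proof.
move=> t; apply: continuous_mx => i j.
rewrite (_ : (fun _ => _) = @clamp R \o (fun t : 'rV[R]_n => t 0 j)); last first.
  by apply/funext => u; rewrite !mxE.
apply: continuous_comp; [exact: coord_continuous|exact: clamp_continuous].
Qed.

Lemma within_clamp (T S U : topologicalType) (A : set S) (r : T -> S) (f : S -> U) :
  continuous r -> (forall t, A (r t)) -> {within A, continuous f} -> continuous (f \o r).
Proof.
move=> cr rA cf; apply/continuous_subspace_setT.
exact: (continuous_within_comp cr _ cf).
Qed.

Lemma spheroid_lift n (x : B) (f : spheroid R x n) e0 : p e0 = f 0 ->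
  exists F : 'rV[R]_n -> E, [/\ continuous F, F 0 = e0 &
    forall t, p (F t) = f (cube_clamp t)].
Proof.
move=> pe0; have [||F [cF F0 pF]] := @cone_lifting R E B p hausE p_inj p_section n
    (f \o (@cube_clamp n)) e0; last by exists F.
  exact: (within_clamp (@cube_clamp_continuous n) (@cube_clamp_cube n)
    (@spheroid_continuous R B x n f)).
by rewrite /= cube_clamp_id // => i; rewrite mxE lexx ler01.
Qed.

Lemma path_lift_const (F : R -> E) : continuous F ->
  (forall s, 0 <= s <= 1 -> p (F s) = p (F 0)) -> forall s, 0 <= s <= 1 -> F s = F 0.
Proof.
move=> cF pF; apply: (@unique_lift R E B p hausE p_inj F (fun=> F 0)) => //.
exact: cst_continuous.
Qed.

(** Move each point of the first lift to the corresponding point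
    of the second one along the chosen segment, then project. *)
Lemma homotopic_lifts n (x : B) (f f' : spheroid R x n) (F F' : 'rV[R]_n -> E) :
  continuous F -> continuous F' ->
  (forall t, cube t -> p (F t) = f t) -> (forall t, cube t -> p (F' t) = f' t) ->
  (forall t, cube_boundary t -> F t = F' t) -> homotopic f f'.
Proof.
move=> cF cF' pF pF' FF'.
exists (fun ts => p (seg (F ts.1, F' ts.1, ts.2))); split.
- apply: continuous_subspaceT => ts.
  apply: (@continuous_comp _ _ _ (fun ts => seg (F ts.1, F' ts.1, ts.2)) p); last exact: p_cont.
  apply: (@continuous_comp _ _ _ (fun ts => (F ts.1, F' ts.1, ts.2)) seg); last exact: seg_cont.
  have cfst : continuous (@fst 'rV[R]_n R) by move=> ?; exact: cvg_fst.
  apply: continuous_pair; last by move=> ?; exact: cvg_snd.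
  by apply: continuous_pair => q; apply: continuous_comp;
    [exact: cfst|exact: cF|exact: cfst|exact: cF'].
- by move=> t ct /=; rewrite seg0 pF.
- by move=> t ct /=; rewrite seg1 pF'.
- by move=> t s bt _ /=; rewrite FF' // seg_diag pF' ?spheroid_boundary //; exact: bt.1.
Qed.

Section Pi1.
Variables (x : B) (e0 : E).
Hypothesis pe0 : p e0 = x.

Definition pt (a : R) : 'rV[R]_1 := \row__ a.

Lemma ptE (t : 'rV[R]_1) : t = pt (t 0 0).
Proof. by apply/rowP => i; rewrite mxE !ord1. Qed.

Lemma pt0 : pt 0 = 0. Proof. by apply/rowP => i; rewrite !mxE. Qed.

Lemma pt_cube s : cube (pt s) <-> 0 <= s <= 1.
Proof. by split=> [/(_ 0)|h i]; rewrite mxE. Qed.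

Lemma pt_boundary s : cube_boundary (pt s) <-> s = 0 \/ s = 1.
Proof.
split=> [[_ [j]]|h]; first by rewrite mxE.
by split; [apply/pt_cube; case: h => ->; rewrite lexx ler01|exists 0; rewrite mxE].
Qed.

Lemma pt_continuous : continuous pt.
Proof.
move=> s; apply: continuous_mx => i j.
rewrite (_ : (fun _ => _) = idfun); first exact: continuous_idf.
by apply/funext => u; rewrite mxE.
Qed.

Lemma spheroid1_0 (f : spheroid R x 1) : f 0 = x.
Proof. by rewrite spheroid_boundary // -pt0; apply/pt_boundary; left. Qed.

Lemma spheroid1_1 (f : spheroid R x 1) : f (pt 1) = x.
Proof. by rewrite spheroid_boundary //; apply/pt_boundary; right. Qed.

Lemma pt01 : ((0 <= (0 : R) <= 1) * (0 <= (1 : R) <= 1))%type.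
Proof. by rewrite !lexx !ler01. Qed.

Definition monodromy (f : spheroid R x 1) g := exists F : 'rV[R]_1 -> E,
  [/\ continuous F, F 0 = e0, forall t, cube t -> p (F t) = f t & F (pt 1) = act g e0].

Lemma monodromy_exists f : exists g, monodromy f g.
Proof.
have [|F [cF F0 pF]] := @spheroid_lift 1 x f e0; first by rewrite spheroid1_0.
have [|g gE] := @p_fibre e0 (F (pt 1)).
  by rewrite pF cube_clamp_id ?spheroid1_1 //; by apply/pt_cube; rewrite pt01.
by exists g, F; split => // t ct; rewrite pF cube_clamp_id.
Qed.

Lemma comp_pt_continuous (F : 'rV[R]_1 -> E) : continuous F -> continuous (F \o pt).
Proof. by move=> cF s; apply: continuous_comp; [exact: pt_continuous|exact: cF]. Qed.

Lemma monodromy_unique f g g' : monodromy f g -> monodromy f g' -> g = g'.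
Proof.
move=> [F [cF F0 pF Fg]] [F' [cF' F'0 pF' F'g]]; apply: (@act_inj _ _ e0).
rewrite -Fg -F'g.
apply: (@unique_lift R E B p hausE p_inj (F \o pt) (F' \o pt)) => //=;
  rewrite ?pt0 ?F0 //; try exact: comp_pt_continuous; last exact: pt01.2.
by move=> s /pt_cube cs; rewrite pF // pF'.
Qed.

(** The lift of a homotopy of loops is constant on the two
    sides of the square, where the homotopy is constant, so all the lifted
    loops have the same ends. *)
Lemma monodromy_homotopic f f' g : monodromy f g -> homotopic f f' -> monodromy f' g.
Proof.
move=> [F [cF F0 pF Fg]] [H [cH H0 H1 Hb]].
pose K (ts : 'rV[R]_1 * R) := H (cube_clamp ts.1, clamp ts.2).
have cK : continuous K.
  apply: (@within_clamp _ _ _ _ (fun ts : 'rV[R]_1 * R => (cube_clamp ts.1, clamp ts.2)) H _ _ cH).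
    apply: continuous_pair => ts; apply: continuous_comp.
    + exact: cvg_fst.
    + exact: cube_clamp_continuous.
    + exact: cvg_snd.
    + exact: clamp_continuous.
  by move=> ts; split => /=; [exact: cube_clamp_cube|exact: clamp01].
have cF' : continuous (F \o @cube_clamp 1).
  by move=> t; apply: continuous_comp; [exact: cube_clamp_continuous|exact: cF].
have pF' t : p ((F \o @cube_clamp 1) t) = K (t, 0).
  rewrite /K /= clamp_id ?pt01 // pF ?H0 //; exact: cube_clamp_cube.
have [L [cL L0 pL]] := @homotopy_lifting R E B p hausE p_inj p_section _ _ _ cK cF' pF'.
have Lb t s : cube_boundary t -> 0 <= s <= 1 -> L (t, s) = F t.
  move=> bt s01; have ct := bt.1.
  rewrite -[F t]/((F \o idfun) t) -{2}(cube_clamp_id ct) -[RHS]/((F \o @cube_clamp 1) t) -L0.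
  apply: (@path_lift_const (fun s => L (t, s))) => //.
    by move=> r; apply: line_continuous; exact: cL.
  move=> r r01; rewrite !pL ?pt01 // /K /= cube_clamp_id // !clamp_id ?pt01 //.
  by rewrite !Hb ?pt01.
exists (fun t => L (t, 1)); split.
- by move=> t; apply: slice_continuous; exact: cL.
- by rewrite Lb ?pt01 // -pt0; apply/pt_boundary; left.
- by move=> t ct; rewrite pL ?pt01 // /K /= cube_clamp_id // clamp_id ?pt01 // H1.
- by rewrite Lb ?pt01 //; apply/pt_boundary; right.
Qed.

Lemma monodromy_inj f f' g : monodromy f g -> monodromy f' g -> homotopic f f'.
Proof.
move=> [F [cF F0 pF Fg]] [F' [cF' F'0 pF' F'g]].
apply: homotopic_lifts cF cF' pF pF' _ => t; rewrite [t]ptE => /pt_boundary[] ->.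
  by rewrite pt0 F0.
by rewrite Fg.
Qed.

Lemma monodromy_surj g : exists f, monodromy f g.
Proof.
pose F (t : 'rV[R]_1) := seg (e0, act g e0, t 0 0).
have cF : continuous F.
  move=> t; apply: (@continuous_comp _ _ _ (fun t : 'rV[R]_1 => (e0, act g e0, t 0 0)) seg);
    last exact: seg_cont.
  by apply: continuous_pair; [exact: cst_continuous|exact: coord_continuous].
have bF t : cube_boundary t -> p (F t) = x.
  by rewrite [t]ptE => /pt_boundary[] ->; rewrite /F mxE ?seg0 ?seg1 ?p_act.
have cpF : {within @cube R 1, continuous (p \o F)}.
  by apply: continuous_subspaceT => t; apply: continuous_comp; [exact: cF|exact: p_cont].
exists (Spheroid cpF bF), F; split => //.
- by rewrite /F mxE seg0.
- by rewrite /F mxE seg1.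
Qed.

(** After the lift of [f], which ends at [g e0], the second half is
    the translate by [g] of the lift of [f']. *)
Lemma monodromy_concat f f' g g' :
  monodromy f g -> monodromy f' g' -> monodromy (concat f f') (g * g')%g.
Proof.
move=> [F [cF F0 pF Fg]] [F' [cF' F'0 pF' F'g]].
pose K (t : 'rV[R]_1) :=
  if t 0 0 <= 2^-1 then F (pt (2 * t 0 0)) else act g (F' (pt (2 * t 0 0 - 1))).
have c00 : continuous (fun t : 'rV[R]_1 => t 0 0) by move=> t; exact: coord_continuous.
have c2 : continuous (fun t : 'rV[R]_1 => 2 * t 0 0).
  exact: continuous_mulf (@continuous_cstf _ _ 2) c00.
exists K; split.
- apply/continuous_subspace_setT.
  apply: (@continuous_within_if R 'rV[R]_1 E setT (fun t => t 0 0) 2^-1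
    (fun t => F (pt (2 * t 0 0))) (fun t => act g (F' (pt (2 * t 0 0 - 1))))) => //.
  + apply: continuous_subspaceT => t.
    by apply: (@continuous_comp _ _ _ (fun t : 'rV[R]_1 => 2 * t 0 0) (F \o pt));
      [exact: c2|exact: comp_pt_continuous].
  + apply: continuous_subspaceT => t.
    apply: (@continuous_comp _ _ _ (fun t : 'rV[R]_1 => 2 * t 0 0 - 1) (act g \o (F' \o pt))).
      exact: (continuous_subf c2 (@continuous_cstf _ _ 1)).
    by apply: continuous_comp; [exact: comp_pt_continuous|exact: act_cont].
  + move=> t _ ->; rewrite mulfV ?pnatr_eq0 // subrr pt0 F'0; exact: Fg.
- by rewrite /K mxE invr_ge0 ler0n mulr0 pt0.
- move=> t ct; have /andP[t0 t1] := ct 0; rewrite /K /= /concat_fun.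
  have sE a : set_coord0 t a = pt a by apply/rowP => i; rewrite !mxE ord1 eqxx.
  rewrite !sE; case: ifPn => [h|]; last rewrite -ltNge => h.
    by rewrite pF //; apply/pt_cube; lra.
  by rewrite p_act pF' //; apply/pt_cube; lra.
- rewrite /K mxE ifF; last by apply/negbTE; rewrite -ltNge; lra.
  by rewrite mulr1 (_ : 2 - 1 = 1) ?F'g ?actM //; ring.
Qed.

(** Monodromy is a morphism by [monodromy_concat]. It is onto because
    the projection of a segment from [e0] to [g e0] is a loop, and one-to-one
    because lifts with the same ends are homotopic along segments. *)
Lemma pi1_isomorphic : isomorphic_groups (homotopy_group R x 1) G.
Proof.
pose D (a : homotopy_group R x 1) : G := sval (cid (monodromy_exists (repr a))).
have DP a : monodromy (repr a) (D a) := svalP (cid (monodromy_exists (repr a))).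
have Dclass f g : monodromy f g -> D (homotopy_class f) = g.
  move=> fg; apply: monodromy_unique (DP _) _; apply: monodromy_homotopic fg _.
  by apply/homotopy_classP; rewrite homotopy_class_repr.
have DM : {morph D : a b / (a * b)%g >-> (a * b)%g}.
  move=> a b; apply: Dclass; exact: monodromy_concat.
pose DMm := isMultiplicative.Build (homotopy_group R x 1) G D DM.
pose Dm : {multiplicative homotopy_group R x 1 -> G} := HB.pack D DMm.
exists Dm.
have [h hP] : exists h : G -> spheroid R x 1, forall g, monodromy (h g) g.
  exists (fun g => sval (cid (monodromy_surj g))) => g; exact: (svalP (cid (monodromy_surj g))).
exists (fun g => homotopy_class (h g)).
- move=> a; rewrite -[RHS]homotopy_class_repr; apply/homotopy_classP.
  exact: monodromy_inj (hP _) (DP a).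
- by move=> g; exact: Dclass.
Qed.

End Pi1.

(** In dimension at least 2 the boundary of the cube is
    connected, so a lift of a spheroid is constant there, and it can be
    contracted to that constant along segments. *)
Lemma higher_homotopy_trivial n (x : B) : (n > 1)%N -> forall a : homotopy_group R x n,
  a = homotopy_class (constant_spheroid R x n).
Proof.
move=> n1 a; rewrite -[LHS]homotopy_class_repr; apply/homotopy_classP.
set f := repr a; have z01 : 0 <= (0 : R) <= 1 by rewrite lexx ler01.
have b0 : cube_boundary (0 : 'rV[R]_n).
  by split=> [i|]; [rewrite mxE|exists (Ordinal (ltnW n1)); left; rewrite mxE].
have [e0 pe0] := p_surj x.
have [|F [cF F0 pF]] := @spheroid_lift n x f e0; first by rewrite spheroid_boundary.
have pFb t : cube_boundary t -> p (F t) = x.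
  by move=> bt; rewrite pF cube_clamp_id ?spheroid_boundary //; exact: bt.1.
have move_bdry (u v : 'rV[R]_n) :
    (forall s, 0 <= s <= 1 -> cube_boundary (u + s *: v)) -> F (u + v) = F u.
  move=> buv; rewrite -[in LHS](scale1r v) -[in RHS](addr0 u) -(scale0r v).
  apply: (@path_lift_const (fun s => F (u + s *: v))).
  - move=> s; apply: (@continuous_comp _ _ _ (fun s : R => u + s *: v) F); last exact: cF.
    by apply: cvgD; [exact: cvg_cst|apply: cvgZr_tmp; exact: cvg_id].
  - by move=> s s01; rewrite !pFb //; exact: buv.
  - by rewrite ler01 lexx.
have FB t : cube_boundary t -> F t = e0.
  move=> [ct [i ti]].
  (* Slide all the coordinates but [i] to 0, which keeps the point on its face;
     then slide [i] to 0, while the coordinate [j] is 0. *)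
  have [j ji] : exists j : 'I_n, j != i.
    have [i0|i0] := eqVneq (val i) 0%N.
      by exists (Ordinal n1); rewrite -val_eqE /= i0.
    by exists (Ordinal (ltnW n1)); rewrite -val_eqE /= eq_sym.
  pose u : 'rV[R]_n := \row_k (if k == i then t 0 i else 0).
  have uE : F u = e0.
    rewrite -F0 -[u]add0r; apply: move_bdry => s s01; rewrite add0r; split.
      move=> k; rewrite !mxE; case: eqP => _; last by rewrite mulr0 z01.
      by have := ct i; move: s01 (t 0 i) => /andP[? ?] ? /andP[? ?]; apply/andP; split; nra.
    by exists j; left; rewrite !mxE (negbTE ji) mulr0.
  rewrite -uE -[t](subrK u) addrC; apply: move_bdry => s s01; split.
    move=> k; rewrite !mxE; case: eqP => [->|_]; first by rewrite subrr mulr0 addr0; exact: ct.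
    rewrite add0r subr0.
    by have := ct k; move: s01 (t 0 k) => /andP[? ?] ? /andP[? ?]; apply/andP; split; nra.
  by exists i; rewrite !mxE eqxx subrr mulr0 addr0.
apply: (@homotopic_lifts _ _ _ _ F (fun=> e0)) => //.
- exact: cst_continuous.
- by move=> t ct; rewrite pF cube_clamp_id.
Qed.

End HomotopyGroupsOfQuotient.

(** * Holomorphic maps in local parametrizations *)

Lemma nbhs_sub (T : topologicalType) (x : T) (A B : set T) :
  nbhs x A -> A `<=` B -> nbhs x B.
Proof. by move=> xA AB; exact: filterS xA. Qed.

Lemma nbhs_meet (T : topologicalType) (x : T) (A B : set T) :
  nbhs x A -> nbhs x B -> nbhs x (A `&` B).
Proof. exact: filterI. Qed.

Lemma near_continuous (T U : topologicalType) (g : T -> U) x (P : set U) :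
  {for x, continuous g} -> nbhs (g x) P -> \forall y \near x, P (g y).
Proof. by move=> cg; exact: cg. Qed.

Section NearDiff.
Variables (K : numFieldType) (V W : normedModType K).
Implicit Types f g : V -> W.

Lemma near_diff f g x : (\forall y \near x, f y = g y) -> differentiable g x ->
  differentiable f x /\ 'd f x = 'd g x :> (V -> W).
Proof.
move=> fg dg; have fgx : f x = g x by exact: nbhs_singleton fg.
have fE : f \o shift x = cst (f x) + 'd g x +o_ 0 id.
  have /eqaddoP gE := diff_locally dg.
  apply/eqaddoP => e e0; have := gE e e0.
  have fg0 : \forall y \near 0, f (y + x) = g (y + x).
    have sx : shift x @ 0 --> x.
      by rewrite -{2}[x]add0r; apply: cvgD; [exact: cvg_id|exact: cvg_cst].
    exact: sx _ fg.
  apply: filterS2 fg0 => y fgy.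
  by rewrite /= !fctE /= fgy fgx.
have dE : 'd f x = 'd g x :> (V -> W) by apply: diff_unique => //; exact: diff_continuous.
split => //; apply/diff_locallyP; rewrite dE; split => //; exact: diff_continuous.
Qed.

End NearDiff.

Arguments atlas {R V} c _.

Section Parametrization.
Variable R : realType.
Local Notation C := R[i].

(** A surrogate for a local biholomorphism [p] from a normed space.
    In each chart it asks only for what is used at a point: [p] and some local
    section of [p] are differentiable there, and the differential of [p] is
    onto. Such a map makes it possible to check holomorphy upstairs, see
    [holomorphic_induced]. *)
Record parametrized (V : normedModType C) (M : charted_space V) (p : V -> M) : Prop := {
  parametrized_continuous : continuous p;
  parametrized_open : forall v A, nbhs v A -> nbhs (p v) (p @` A);
  parametrized_chart : forall c v, atlas M c -> chart_dom c (p v) ->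
    differentiable (c \o p) v /\ forall w, exists u, 'd (c \o p) v u = w;
  parametrized_section : forall c v, atlas M c -> chart_dom c (p v) ->
    exists2 s : V -> V, s (c (p v)) = v /\ differentiable s (c (p v)) &
      \forall w \near c (p v), chart_inv c w = p (s w) }.

Section Induced.
Variables (V W : normedModType C) (M : charted_space V) (N : charted_space W).
Variables (pM : V -> M) (pN : W -> N).
Hypotheses (parM : parametrized pM) (parN : parametrized pN).
Variables (f : M -> N) (F : V -> W) (v : V).
Hypothesis fF : \forall u \near v, f (pM u) = pN (F u).
Hypothesis dF : differentiable F v.

Lemma continuous_induced : {for pM v, continuous f}.
Proof.
move=> A; rewrite (nbhs_singleton fF) => hA.
have h1 : \forall u \near v, A (pN (F u)).
  apply: (@near_continuous _ _ F _ (pN @^-1` A)).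
    exact: differentiable_continuous dF.
  exact: (parametrized_continuous parN hA).
apply: nbhs_sub (parametrized_open parM (nbhs_meet fF h1)) _.
by move=> _ [u [fu Au] <-]; rewrite /= fu.
Qed.

(** In charts, [f] is the composition of a local section of [pM],
    of [F] and of [pN] followed by a chart. *)
Lemma holomorphic_induced : holomorphic_at f (pM v).
Proof.
split; first exact: continuous_induced.
move=> c d ac ad cv dv; have dv' : chart_dom d (pN (F v)) by rewrite -(nbhs_singleton fF).
have [s [sv ds] sE] := parametrized_section parM ac cv.
have [dd _] := parametrized_chart parN ad dv'.
apply: (@near_diff _ _ _ _ ((d \o pN) \o (F \o s)) _ _ _).1.
  have fFs : \forall w \near c (pM v), f (pM (s w)) = pN (F (s w)).
    apply: (@near_continuous _ _ s _ (fun u => f (pM u) = pN (F u))).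
      exact: differentiable_continuous ds.
    by rewrite sv.
  by apply: filterS2 fFs sE => w fw sw; rewrite /= sw fw.
have dFs : differentiable F (s (c (pM v))) by rewrite sv.
apply: differentiable_comp; first exact: differentiable_comp.
by rewrite /= sv.
Qed.

End Induced.

Lemma parametrized_vector_space (V : normedModType C) :
  parametrized (id : V -> vector_space V).
Proof.
split.
- exact: continuous_idf.
- by move=> v A; rewrite image_id.
- move=> c v -> _ /=; have d := @linear_differentiable C V V idfun v (@continuous_idf V).
  by split => // w; exists w; rewrite (@diff_lin _ _ _ idfun) //; exact: continuous_idf.
- move=> c v -> _ /=; exists id; last by near=> w.
  split => //; exact: (@linear_differentiable C V V idfun v (@continuous_idf V)).
Unshelve. all: by end_near. Qed.

Lemma submersion_induced (V W : normedModType C) (N : charted_space W) (pN : W -> N)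
    (f : V -> N) (F : V -> W) v : parametrized pN ->
  (forall u, f u = pN (F u)) -> differentiable F v -> (forall w, exists u, 'd F v u = w) ->
  submersion_at (M := vector_space V) f v.
Proof.
move=> parN fF dF sF; split.
  apply: (@holomorphic_induced V W (vector_space V) N id pN _ _ f F) => //.
    exact: parametrized_vector_space.
  by near=> u; exact: fF.
move=> c d -> ad _ dv w /=; rewrite fF in dv.
have [dd sd] := parametrized_chart parN ad dv.
have -> : d \o f \o idfun = (d \o pN) \o F by apply/funext => u; rewrite /= fF.
have [w' w'E] := sd w; have [u uE] := sF w'; exists u.
by rewrite diff_comp //= uE.
Unshelve. all: by end_near. Qed.

Lemma parametrized_prod (V W : normedModType C) (M : charted_space V) (N : charted_space W)
    (pM : V -> M) (pN : W -> N) : parametrized pM -> parametrized pN ->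
  @parametrized _ (prod_space M N) (fun vw => (pM vw.1, pN vw.2)).
Proof.
move=> parM parN.
have dfst q : differentiable (@fst V W) q.
  by apply: (@linear_differentiable _ _ _ fst) => ?; exact: cvg_fst.
have dsnd q : differentiable (@snd V W) q.
  by apply: (@linear_differentiable _ _ _ snd) => ?; exact: cvg_snd.
have Dfst q : 'd (@fst V W) q = fst :> (V * W -> V).
  by apply: (@diff_lin _ _ _ fst) => ?; exact: cvg_fst.
have Dsnd q : 'd (@snd V W) q = snd :> (V * W -> W).
  by apply: (@diff_lin _ _ _ snd) => ?; exact: cvg_snd.
split.
- apply: (@continuous_pair _ _ _ (pM \o fst) (pN \o snd)) => q; apply: continuous_comp.
  + exact: cvg_fst.
  + exact: parametrized_continuous.
  + exact: cvg_snd.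
  + exact: parametrized_continuous.
- move=> [v w] A [[A1 A2] /= [h1 h2] sA].
  exists (pM @` A1, pN @` A2) => /=.
    by split; exact: parametrized_open.
  by move=> [x y] [/= [v' Av' <-] [w' Aw' <-]]; exists (v', w') => //; exact: sA.
- move=> e [v w] [c ac [d ad ->]] [/= cv dw].
  have [d1 s1] := parametrized_chart parM ac cv.
  have [d2 s2] := parametrized_chart parN ad dw.
  have e1 : differentiable ((c \o pM) \o fst) (v, w) by apply: differentiable_comp.
  have e2 : differentiable ((d \o pN) \o snd) (v, w) by apply: differentiable_comp.
  split; first exact: (differentiable_pair e1 e2).
  move=> [w1 w2]; have [u1 u1E] := s1 w1; have [u2 u2E] := s2 w2.
  exists (u1, u2).
  rewrite (@diff_pair _ _ _ _ ((c \o pM) \o fst) ((d \o pN) \o snd)) //.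
  by rewrite !diff_comp //= Dfst Dsnd u1E u2E.
- move=> e [v w] [c ac [d ad ->]] [/= cv dw].
  have [s [sv ds] sE] := parametrized_section parM ac cv.
  have [t [tw dt] tE] := parametrized_section parN ad dw.
  exists (fun q => (s q.1, t q.2)) => /=.
    split; first by rewrite sv tw.
    apply: (@differentiable_pair _ _ _ _ (s \o fst) (t \o snd)); exact: differentiable_comp.
  have h1 : \forall q \near (c (pM v), d (pN w)), chart_inv c q.1 = pM (s q.1).
    exact: (@cvg_fst _ _ (nbhs (c (pM v))) (nbhs (d (pN w))) _ _ sE).
  have h2 : \forall q \near (c (pM v), d (pN w)), chart_inv d q.2 = pN (t q.2).
    exact: (@cvg_snd _ _ (nbhs (c (pM v))) (nbhs (d (pN w))) _ _ tE).
  by apply: filterS2 h1 h2 => q /= -> ->.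
Qed.

End Parametrization.

(** * Quotients of a normed space by a proper action *)

Lemma diff_right_inverse (K : numFieldType) (V W : normedModType K) (f : V -> W) (h : W -> V) x y :
  cancel h f -> h y = x -> differentiable f x -> differentiable h y ->
  forall w, 'd f x ('d h y w) = w.
Proof.
move=> hK hy; rewrite -hy => df dh w.
have := congr1 (fun k => k w) (diff_comp dh df); rewrite /= => <-.
have -> : f \o h = idfun by apply/funext => z /=; exact: hK.
by rewrite (@diff_lin _ W W idfun _ (@continuous_idf W)).
Qed.

Section OrbitSpace.
Variables (R : realType) (V : normedModType R[i]) (G : groupType) (act : G -> V -> V).

(** Either [v] is the image of [u] by an element, and then near [u] and [v]
    only such elements matter, or [u] and [v] have neighbourhoods that no
    element brings together. For a free action this gives at once the slices
    and the Hausdorff property of the quotient. *)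
Definition separating := forall u v, exists2 AB : set V * set V,
  open_nbhs u AB.1 /\ open_nbhs v AB.2 &
  forall g z, AB.1 z -> AB.2 (act g z) -> act g u = v.

Record proper_action : Prop := ProperAction {
  proper_act1 : forall v, act 1%g v = v;
  proper_actM : forall g h v, act (g * h)%g v = act g (act h v);
  proper_act_free : forall g v, act g v = v -> g = 1%g;
  proper_act_diff : forall g v, differentiable (act g) v;
  proper_act_separating : separating }.

Hypothesis actP : proper_action.
Let act1 := proper_act1 actP.
Let actM := proper_actM actP.

Lemma proper_actK g v : act (g^-1)%g (act g v) = v.
Proof. by rewrite -actM mulVg act1. Qed.

Lemma proper_actVK g v : act g (act (g^-1)%g v) = v.
Proof. by rewrite -actM mulgV act1. Qed.

Lemma proper_act_continuous g : continuous (act g).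
Proof. move=> v; exact/differentiable_continuous/(proper_act_diff actP). Qed.

Definition same_orbit (u v : V) : bool := `[< exists g, act g u = v >].

Lemma same_orbit_refl : reflexive same_orbit.
Proof. by move=> u; apply/asboolP; exists 1%g; exact: act1. Qed.

Lemma same_orbit_sym : symmetric same_orbit.
Proof.
suff S u v : same_orbit u v -> same_orbit v u by move=> u v; apply/idP/idP; exact: S.
by move=> /asboolP[g <-]; apply/asboolP; exists (g^-1)%g; exact: proper_actK.
Qed.

Lemma same_orbit_trans : transitive same_orbit.
Proof.
move=> v u w /asboolP[g <-] /asboolP[h <-]; apply/asboolP.
by exists (h * g)%g; rewrite actM.
Qed.

Definition same_orbit_equiv :=
  EquivRel same_orbit same_orbit_refl same_orbit_sym same_orbit_trans.

Definition orbit_space : topologicalType := quotient_topology {eq_quot same_orbit_equiv}.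

Definition orbit_class (v : V) : orbit_space :=
  (\pi_{eq_quot same_orbit_equiv} v : {eq_quot same_orbit_equiv}).

Lemma orbitP u v : orbit_class u = orbit_class v <-> exists g, act g u = v.
Proof.
by split=> [/(@eqmodP _ same_orbit_equiv)/asboolP|uv];
  last exact/(@eqmodP _ same_orbit_equiv)/asboolP.
Qed.

Lemma orbit_surj (b : orbit_space) : exists v, orbit_class v = b.
Proof. exists (repr (b : {eq_quot same_orbit_equiv})); exact: reprK. Qed.

Lemma orbit_act g v : orbit_class (act g v) = orbit_class v.
Proof. by apply/esym/orbitP; exists g. Qed.

Lemma orbit_continuous : continuous orbit_class.
Proof. exact: (@pi_continuous V {eq_quot same_orbit_equiv}). Qed.

Lemma orbit_open (U : set V) : open U -> open (orbit_class @` U).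
Proof.
move=> oU; suff : open (orbit_class @^-1` (orbit_class @` U)) by [].
have -> : orbit_class @^-1` (orbit_class @` U) = \bigcup_g (act g @^-1` U).
  apply/seteqP; split=> v /=.
    by move=> [u Uu /esym/orbitP[g gu]]; exists g => //=; rewrite gu.
  by move=> [g _ /= Ugv]; exists (act g v) => //; exact: orbit_act.
apply: bigcup_open => g _; apply: open_comp => // v _; exact: proper_act_continuous.
Qed.

Lemma orbit_nbhs v (A : set V) : nbhs v A -> nbhs (orbit_class v) (orbit_class @` A).
Proof.
move=> vA; have [U [oU Uv] UA] : exists2 U, open_nbhs v U & U `<=` A.
  by move: vA; rewrite nbhsE.
apply: (@nbhs_sub _ _ (orbit_class @` U)); last exact: image_subset.
by apply: open_nbhs_nbhs; split; [exact: orbit_open|exists v].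
Qed.

(** An open set that is disjoint from all its other translates, on which
    the projection is therefore injective. *)
Definition slice_set (W : set V) := open W /\ forall g u, W u -> W (act g u) -> g = 1%g.

Lemma slice_exists v : exists2 W, slice_set W & W v.
Proof.
have [[A B] [[oA Av] [oB Bv]] AB] := proper_act_separating actP v v.
exists (A `&` B); last by split.
split; first exact: openI.
by move=> g u [Au _] [_ Bgu]; apply: (proper_act_free actP (v := v)); exact: AB Au Bgu.
Qed.

Definition slice_lift (W : set V) (b : orbit_space) : V :=
  xget 0 (W `&` [set v | orbit_class v = b]).

Lemma slice_liftP W b :
  (orbit_class @` W) b -> W (slice_lift W b) /\ orbit_class (slice_lift W b) = b.
Proof.
move=> [v Wv vb]; have h : (W `&` [set v | orbit_class v = b]) v by [].
exact: (@xgetI _ 0 _ v h).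
Qed.

Lemma slice_inj W u v : slice_set W -> W u -> W v -> orbit_class u = orbit_class v -> u = v.
Proof.
move=> [_ sW] Wu Wv /orbitP[g gu]; rewrite -gu in Wv *.
by rewrite (sW g u) // act1.
Qed.

Lemma slice_lift_orbit W v : slice_set W -> W v -> slice_lift W (orbit_class v) = v.
Proof.
move=> sW Wv; have [|h1 h2] := @slice_liftP W (orbit_class v); first by exists v.
exact: slice_inj sW h1 Wv h2.
Qed.

Lemma slice_lift_continuous W b : slice_set W -> (orbit_class @` W) b ->
  {for b, continuous (slice_lift W)}.
Proof.
move=> sW Wb A hA; have [Wl lb] := slice_liftP Wb.
have : nbhs b (orbit_class @` (A `&` W)).
  rewrite -{1}lb; apply: orbit_nbhs; apply: nbhs_meet hA _.
  exact: open_nbhs_nbhs (conj sW.1 Wl).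
move=> /nbhs_sub; apply=> _ [v [Av Wv] <-] /=.
by rewrite slice_lift_orbit.
Qed.

Definition slice_chart W : chart orbit_space V :=
  Chart (orbit_class @` W) (slice_lift W) orbit_class.

Definition orbit_charted : charted_space V :=
  @ChartedSpace R V orbit_space [set c | exists2 W, slice_set W & c = slice_chart W].

(** Read in charts of slices, the projection and the changes of
    charts are locally maps of the action, hence holomorphic. *)
Lemma slice_lift_near W v g : slice_set W -> W (act g v) ->
  \forall u \near v, slice_lift W (orbit_class u) = act g u.
Proof.
move=> sW Wgv; have : \forall u \near v, W (act g u).
  by apply: near_continuous (open_nbhs_nbhs (conj sW.1 Wgv)); exact: proper_act_continuous.
by apply: filterS => u Wgu; rewrite -(orbit_act g) slice_lift_orbit.
Qed.

Lemma orbit_parametrized : parametrized (orbit_class : V -> orbit_charted).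
Proof.
split.
- exact: orbit_continuous.
- exact: orbit_nbhs.
- move=> _ v [W sW ->] /= [u Wu /esym/orbitP[g gvu]]; rewrite -gvu in Wu.
  have [d dE] := near_diff (slice_lift_near sW Wu) (proper_act_diff actP g v).
  split; first exact: d.
  move=> w; rewrite /comp dE.
  exists ('d (act (g^-1)%g) (act g v) w).
  apply: diff_right_inverse (proper_actVK g) (proper_actK g v) _ _ w; exact: proper_act_diff.
- move=> _ v [W sW ->] /= [u Wu /esym/orbitP[g gvu]]; rewrite -gvu in Wu.
  exists (act (g^-1)%g); last by near=> w; rewrite orbit_act.
  rewrite -(orbit_act g) slice_lift_orbit // proper_actK; split => //.
  exact: (proper_act_diff actP).
Unshelve. all: by end_near. Qed.

Lemma orbit_hausdorff : hausdorff_space orbit_space.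
Proof.
rewrite open_hausdorff => x y xy.
have [u ux] := orbit_surj x; have [v vy] := orbit_surj y.
have [[A B] /= [[oA Au] [oB Bv]] AB] := proper_act_separating actP u v.
exists (orbit_class @` A, orbit_class @` B) => /=.
  by split; apply/mem_set; [exists u|exists v].
split; [exact: orbit_open|exact: orbit_open|].
apply/eqP/seteqP; split => // z [[a Aa <-] [b Bb /esym/orbitP[g gab]]].
rewrite -gab in Bb; move/eqP: xy; apply; rewrite -ux -vy.
by apply/orbitP; exists g; exact: AB Aa Bb.
Qed.

Lemma orbit_second_countable : @second_countable V -> @second_countable orbit_space.
Proof.
move=> [BV cB [oB BB]]; exists ((fun U => orbit_class @` U) @` BV).
  exact: sub_countable (card_image_le _ _) cB.
split; first by move=> _ [U BU <-]; exact/orbit_open/oB.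
move=> x A hA; have [v vx] := orbit_surj x.
have hvA : nbhs v (orbit_class @^-1` A) by apply: orbit_continuous; rewrite vx.
have [U [BU Uv] UA] := BB v _ hvA.
exists (orbit_class @` U); first by split; [exists U|exists v].
by move=> _ [u Uu <-]; exact: UA.
Qed.

Lemma slice_chart_is_chart W : slice_set W -> is_chart (slice_chart W).
Proof.
move=> sW; have imE : chart_image (slice_chart W) = W.
  apply/seteqP; split => [_ [b Wb <-]|v Wv] /=; first exact: (slice_liftP Wb).1.
  by exists (orbit_class v); [exists v|exact: slice_lift_orbit].
split.
- exact: orbit_open sW.1.
- by rewrite imE; exact: sW.1.
- by move=> b /set_mem Wb; exact: (slice_liftP Wb).2.
- by apply: continuous_in_subspaceT => b /set_mem Wb; exact: slice_lift_continuous.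
- by apply: continuous_subspaceT; exact: orbit_continuous.
Qed.

Lemma orbit_cover (x : orbit_charted) : exists2 c, atlas orbit_charted c & chart_dom c x.
Proof.
have [v vx] := orbit_surj x; have [W sW Wv] := slice_exists v.
by exists (slice_chart W); [exists W|exists v].
Qed.

Lemma orbit_transitions c d : atlas orbit_charted c -> atlas orbit_charted d ->
  holomorphic_transition c d.
Proof.
move=> [W sW ->] ad x [v Wv <-] dx.
rewrite /= slice_lift_orbit //.
exact: (parametrized_chart orbit_parametrized ad dx).1.
Qed.

Lemma orbit_charts c : atlas orbit_charted c -> is_chart c.
Proof. by move=> [W sW ->]; exact: slice_chart_is_chart. Qed.

Definition orbit_manifold (sc : @second_countable V) : complex_manifold V :=
  @ComplexManifold R V orbit_charted orbit_hausdorff (orbit_second_countable sc)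
    orbit_charts orbit_cover orbit_transitions.

Lemma orbit_local_inj v : exists2 W, open_nbhs v W &
  forall x y, W x -> W y -> orbit_class x = orbit_class y -> x = y.
Proof.
have [W sW Wv] := slice_exists v; exists W; first by split => //; exact: sW.1.
by move=> x y; exact: slice_inj.
Qed.

(** The projection of a slice is evenly covered: its sheets are the
    translates of the slice. *)
Lemma orbit_section (b : orbit_space) : exists2 U, open_nbhs b U &
  forall v, U (orbit_class v) -> exists2 sec : orbit_space -> V, sec (orbit_class v) = v &
    forall b', U b' -> {for b', continuous sec} /\ orbit_class (sec b') = b'.
Proof.
have [w wb] := orbit_surj b; have [W sW Ww] := slice_exists w.
exists (orbit_class @` W).
  by split; [exact: orbit_open sW.1|exists w].
move=> v [u Wu /orbitP[g guv]]; exists (act g \o slice_lift W).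
  by rewrite /= -guv orbit_act slice_lift_orbit.
move=> b' Wb'; split; last by rewrite /= orbit_act (slice_liftP Wb').2.
apply: continuous_comp; first exact: slice_lift_continuous.
exact: proper_act_continuous.
Qed.

End OrbitSpace.

(** * Ellipticity of quotients by affine actions *)

(** A linear map on row vectors is a finite sum of coordinates
    times constant vectors. *)
Lemma linear_rV_differentiable (K : numFieldType) n (W : normedModType K)
    (l : 'rV[K]_n -> W) x : linear l -> differentiable l x.
Proof.
move=> ll; pose lM := GRing.isLinear.Build _ _ _ _ l ll.
pose L : {linear 'rV[K]_n -> W} := HB.pack l lM.
have -> : l = \sum_(i < n) (fun w : 'rV[K]_n => w 0 i *: l (delta_mx 0 i)).
  apply/funext => w; rewrite {1}(row_sum_delta w) -[l]/(L : _ -> _) linear_sum fct_sumE.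
  by apply: eq_bigr => i _; rewrite linearZ.
apply: differentiable_sum => i.
by apply: differentiableZl; exact: differentiable_coord.
Qed.

Lemma linear_rV_diff (K : numFieldType) n (W : normedModType K)
    (l : 'rV[K]_n -> W) x : linear l -> 'd l x = l :> ('rV[K]_n -> W).
Proof.
move=> ll; pose lM := GRing.isLinear.Build _ _ _ _ l ll.
pose L : {linear 'rV[K]_n -> W} := HB.pack l lM.
apply: (@diff_lin _ _ _ L) => y; apply: differentiable_continuous.
exact: linear_rV_differentiable.
Qed.

Lemma affine_rV_diff (K : numFieldType) n (W : normedModType K)
    (l : 'rV[K]_n -> W) (c : W) x : linear l ->
  differentiable (fun w => l w + c) x /\ 'd (fun w => l w + c) x = l :> ('rV[K]_n -> W).
Proof.
move=> ll; have dl := linear_rV_differentiable x ll.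
have dc : differentiable (cst c : 'rV[K]_n -> W) x := differentiable_cst c x.
split; first exact: (differentiableD dl dc).
apply/funext => w; have /(congr1 (fun k => k w)) /= E := diffD dl dc.
apply: etrans E _; rewrite diff_cst linear_rV_diff //; exact: addr0.
Qed.

Lemma second_countable_prod (T U : topologicalType) :
  @second_countable T -> @second_countable U -> @second_countable (T * U)%type.
Proof.
move=> [A cA [oA AA]] [B cB [oB BB]].
exists ((fun q => q.1 `*` q.2) @` (A `*` B)).
  apply: sub_countable (card_image_le _ _) _; exact: countableX.
split; first by move=> _ [q [/= /oA oq1 /oB oq2] <-]; exact: open_prod.
move=> [x y] N [[N1 N2] /= [h1 h2] sN].
have [a [Aa ax] aN] := AA x _ h1; have [b [Bb bx] bN] := BB y _ h2.
exists (a `*` b); first by split => //; exists (a, b).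
by move=> q [/aN q1 /bN q2]; exact: sN.
Qed.

Section AffineQuotient.
Variables (R : realType) (n : nat).
Local Notation V := ('rV[R[i]]_n : normedModType R[i]).
Variables (G : groupType) (act lin : G -> V -> V).
Hypothesis actP : proper_action act.
Hypothesis lin_linear : forall g, linear (lin g).
Hypothesis actD : forall g u v, act g (u + v) = lin g u + act g v.
Hypothesis scV : @second_countable V.

Lemma lin1 u : lin 1%g u = u.
Proof.
by have := actD 1%g u 0; rewrite addr0 !(proper_act1 actP) addr0.
Qed.

(** The linear part is determined by the action, so it is multiplicative. *)
Lemma linM g h u : lin (g * h)%g u = lin g (lin h u).
Proof.
apply: (@addIr _ (act (g * h)%g 0)); rewrite -actD addr0.
by rewrite !(proper_actM actP) -[in LHS](addr0 u) actD actD.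
Qed.

Lemma lin_differentiable g u : differentiable (lin g) u.
Proof. exact: linear_rV_differentiable. Qed.

(** The derivative of the action; its quotient is the tangent bundle of
    the quotient. *)
Definition tangent_act g (vu : V * V) : V * V := (act g vu.1, lin g vu.2).

Lemma fst_differentiable (q : V * V) : differentiable (@fst V V) q.
Proof. by apply: (@linear_differentiable _ _ _ fst) => ?; exact: cvg_fst. Qed.

Lemma snd_differentiable (q : V * V) : differentiable (@snd V V) q.
Proof. by apply: (@linear_differentiable _ _ _ snd) => ?; exact: cvg_snd. Qed.

Lemma prod_differentiable (f h : V -> V) (q : V * V) :
  differentiable f q.1 -> differentiable h q.2 ->
  differentiable (fun vu : V * V => (f vu.1, h vu.2)) q.
Proof.
move=> df dh; apply: (@differentiable_pair _ _ _ _ (f \o fst) (h \o snd)).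
  by apply: differentiable_comp; [exact: fst_differentiable|exact: df].
by apply: differentiable_comp; [exact: snd_differentiable|exact: dh].
Qed.

(** Two points over the same orbit are related by one element
    only, since the action on the base is free. If that element does not match
    the vectors, they are separated in the second factor. *)
Lemma tangent_act_separating : separating tangent_act.
Proof.
move=> [v a] [w b]; have [[A B] /= [[oA Av] [oB Bw]] AB] := proper_act_separating actP v w.
have [[g gvw]|none] := pselect (exists g, act g v = w); last first.
  exists (A `*` setT, B `*` setT).
    split; (split; first by apply: open_prod => //; exact: openT); by [].
  by move=> g z [/= Az _] [/= Bz _]; case: none; exists g; exact: AB Az Bz.
have gP h : act h v = w -> h = g.
  rewrite -gvw => hg; have : act (g^-1 * h)%g v = v.
    by rewrite (proper_actM actP) hg (proper_actK actP).
  by move=> /(proper_act_free actP)/(congr1 (fun k => g * k)%g); rewrite mulVKg mulg1.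
have [lab|/eqP lab] := pselect (lin g a = b).
  exists (A `*` setT, B `*` setT).
    split; (split; first by apply: open_prod => //; exact: openT); by [].
  move=> h z [/= Az _] [/= Bz _]; have hg := gP _ (AB _ _ Az Bz).
  by rewrite /tangent_act /= hg gvw lab.
have hV : hausdorff_space V by exact: norm_hausdorff.
move: hV; rewrite open_hausdorff => /(_ _ _ lab).
move=> [[P Q] /= [/set_mem Pl /set_mem Qb] [oP oQ /eqP PQ]].
have cl : continuous (lin g) by move=> u; exact/differentiable_continuous/lin_differentiable.
exists (A `*` (lin g @^-1` P), B `*` Q).
  split; split => //; apply: open_prod => //.
  by apply: open_comp => // u _; exact: cl.
move=> h [z1 z2] [/= Az Pz] [/= Bz Qz]; have hg := gP _ (AB _ _ Az Bz).
have : (P `&` Q) (lin g z2) by split => //; rewrite -hg.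
by rewrite PQ.
Qed.

Lemma tangent_act_proper : proper_action tangent_act.
Proof.
split.
- by move=> [v u]; rewrite /tangent_act /= (proper_act1 actP) lin1.
- by move=> g h [v u]; rewrite /tangent_act /= (proper_actM actP) linM.
- by move=> g [v u] [/(proper_act_free actP)].
- move=> g q; apply: prod_differentiable; first exact: proper_act_diff.
  exact: lin_differentiable.
- exact: tangent_act_separating.
Qed.

Definition affine_quotient : complex_manifold V := orbit_manifold actP scV.

Definition tangent_total : complex_manifold (V * V)%type :=
  orbit_manifold tangent_act_proper (second_countable_prod scV scV).

Definition vclass (v : V) : affine_quotient := orbit_class actP v.
Definition tclass (vu : V * V) : tangent_total := orbit_class tangent_act_proper vu.

Definition vrep (x : affine_quotient) : V := sval (cid (orbit_surj x)).
Definition trep (e : tangent_total) : V * V := sval (cid (orbit_surj e)).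

Lemma vrepK x : vclass (vrep x) = x.
Proof. exact: (svalP (cid (orbit_surj x))). Qed.

Lemma trepK e : tclass (trep e) = e.
Proof. exact: (svalP (cid (orbit_surj e))). Qed.

Lemma vclassP u v : vclass u = vclass v <-> exists g, act g u = v.
Proof. exact: orbitP. Qed.

Lemma tclassP p q : tclass p = tclass q <-> exists g, tangent_act g p = q.
Proof. exact: orbitP. Qed.

Lemma trep_class q : exists g, trep (tclass q) = tangent_act g q.
Proof. by have /esym/tclassP[g gq] := trepK (tclass q); exists g. Qed.

Lemma vclass_act g v : vclass (act g v) = vclass v.
Proof. exact: orbit_act. Qed.

Lemma tclass_act g q : tclass (tangent_act g q) = tclass q.
Proof. exact: orbit_act. Qed.

Definition tangent_proj (e : tangent_total) : affine_quotient := vclass (trep e).1.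

Lemma tangent_projE q : tangent_proj (tclass q) = vclass q.1.
Proof. by rewrite /tangent_proj; have [g ->] := trep_class q; exact: vclass_act. Qed.

Definition tangent_fibre (x : affine_quotient) : lmodType R[i] := V.

Definition tangent_incl (x : affine_quotient) (u : tangent_fibre x) : tangent_total :=
  tclass (vrep x, u).

Lemma vparametrized : parametrized (vclass : V -> affine_quotient).
Proof. exact: orbit_parametrized. Qed.

Lemma tparametrized : parametrized (tclass : V * V -> tangent_total).
Proof. exact: orbit_parametrized. Qed.

Lemma tangent_proj_holomorphic : holomorphic tangent_proj.
Proof.
move=> e; rewrite -(trepK e); apply: (holomorphic_induced tparametrized vparametrized (F := fst)).
  by near=> q; exact: tangent_projE.
exact: fst_differentiable.
Unshelve. all: by end_near. Qed.

Lemma tangent_incl_injective x : injective (@tangent_incl x).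
Proof.
move=> u u' /tclassP[g]; rewrite /tangent_act /= => -[/(proper_act_free actP) ->].
by rewrite lin1.
Qed.

Lemma tangent_incl_range x : range (@tangent_incl x) = tangent_proj @^-1` [set x].
Proof.
apply/seteqP; split=> [_ [u _ <-]|e /=].
  by rewrite /= tangent_projE vrepK.
rewrite -(trepK e) tangent_projE -{1}(vrepK x) => /vclassP[g gv].
exists (lin g (trep e).2) => //; rewrite /tangent_incl -gv.
exact: (tclass_act g (trep e)).
Qed.

Section Trivialization.
Variables (W : set V) (sW : slice_set act W).
Let U : set affine_quotient := vclass @` W.

(** The element that brings [v] into the slice; the value 1 is a
    default for the points whose orbit does not meet the slice. *)
Definition slice_elt (v : V) : G := xget 1%g [set g | W (act g v)].

Lemma slice_eltP v g : W (act g v) -> slice_elt v = g.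
Proof.
move=> Wgv; apply: (@xget_unique _ 1%g [set g | W (act g v)] g) => // h /= Whv.
have : (h * g^-1)%g = 1%g.
  apply: sW.2 Wgv _; by rewrite -(proper_actM actP) mulgVK.
by move/(congr1 (fun k => k * g)%g); rewrite mulgVK mul1g.
Qed.

(** Over a slice each class has one representative whose base point is
    in the slice. Its second component is the fibre coordinate. *)
Definition triv_map (e : tangent_total) : prod_space affine_quotient (vector_space V) :=
  let q := trep e in (vclass q.1, lin (slice_elt q.1) q.2).

Definition triv_inv (q : prod_space affine_quotient (vector_space V)) : tangent_total :=
  tclass (slice_lift W q.1, q.2).

Lemma triv_mapE v u g : W (act g v) -> triv_map (tclass (v, u)) = (vclass v, lin g u).
Proof.
move=> Wgv; rewrite /triv_map; have [h ->] := trep_class (v, u).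
rewrite /tangent_act /= vclass_act.
have -> : slice_elt (act h v) = (g * h^-1)%g.
  by apply: slice_eltP; rewrite (proper_actM actP) (proper_actK actP).
by rewrite -linM mulgVK.
Qed.

Lemma triv_invE v u g : W (act g v) -> triv_inv (vclass v, u) = tclass (act g v, u).
Proof.
move=> Wgv; rewrite /triv_inv /= -(vclass_act g).
by rewrite (slice_lift_orbit actP sW Wgv).
Qed.

Lemma slice_open_near v g : W (act g v) -> \forall v' \near v, W (act g v').
Proof.
move=> Wgv; apply: near_continuous (open_nbhs_nbhs (conj sW.1 Wgv)).
exact: (proper_act_continuous actP).
Qed.

Lemma over_slice v : U (vclass v) -> exists g, W (act g v).
Proof. by move=> [w Ww /esym/vclassP[g gv]]; exists g; rewrite gv. Qed.

Lemma tangent_trivialization : local_trivialization tangent_proj tangent_incl U triv_map triv_inv.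
Proof.
split.
- exact: orbit_open sW.1.
- move=> e; rewrite -(trepK e); case: (trep e) => v u.
  rewrite tangent_projE => /over_slice[g Wgv]; rewrite (triv_mapE u Wgv); split => //.
  by rewrite (triv_invE _ Wgv) -[RHS](tclass_act g).
- move=> [x u] /= [v Wv <-].
  have Wv1 : W (act 1%g v) by rewrite (proper_act1 actP).
  rewrite (triv_invE _ Wv1) (proper_act1 actP) tangent_projE; split => //.
  by rewrite (triv_mapE u Wv1) lin1.
- split=> [e|[x u]].
    rewrite -(trepK e) /= tangent_projE; case: (trep e) => v u /= /over_slice[g Wgv].
    apply: (holomorphic_induced tparametrized
      (parametrized_prod vparametrized (parametrized_vector_space V))
      (F := fun vu => (vu.1, lin g vu.2))).
      have h : \forall vu \near (v, u), W (act g vu.1).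
        exact: (@cvg_fst _ _ (nbhs v) (nbhs u) _ _ (slice_open_near Wgv)).
      by apply: filterS h => -[v' u'] /= /triv_mapE ->.
    apply: (@prod_differentiable idfun (lin g)); last exact: lin_differentiable.
    exact: (@linear_differentiable _ V V idfun _ (@continuous_idf V)).
  rewrite /= -(vrepK x) => /over_slice[g Wgv].
  apply: (@holomorphic_induced _ _ _ _ _ _ _
    (parametrized_prod vparametrized (parametrized_vector_space V)) tparametrized
    triv_inv (fun vu => (act g vu.1, vu.2)) (vrep x, u)).
    have h : \forall vu \near (vrep x, u), W (act g vu.1).
      exact: (@cvg_fst _ _ (nbhs (vrep x)) (nbhs u) _ _ (slice_open_near Wgv)).
    by apply: filterS h => -[v' u'] /= /triv_invE ->.
  apply: (@prod_differentiable (act g) idfun); first exact: (proper_act_diff actP).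
  exact: (@linear_differentiable _ V V idfun _ (@continuous_idf V)).
- move=> x; rewrite -{1}(vrepK x) => /over_slice[g Wgv] a u v.
  by rewrite /tangent_incl !(triv_mapE _ Wgv) /= lin_linear.
Qed.

End Trivialization.

Lemma tangent_locally_trivial x : exists U, U x /\
  exists phi psi, local_trivialization tangent_proj tangent_incl U phi psi.
Proof.
have [W sW Wx] := slice_exists actP (vrep x).
exists (vclass @` W); split; first by exists (vrep x) => //; exact: vrepK.
by exists (triv_map W), (triv_inv W); exact: tangent_trivialization.
Qed.

Definition tangent_bundle : vector_bundle affine_quotient n :=
  VectorBundle tangent_proj_holomorphic tangent_incl_injective tangent_incl_range
    tangent_locally_trivial.

(** The class of [(v, u)] goes to the class of [v + u]. This does not
    depend on the representative because the action is affine. *)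
Definition exponential_spray (e : total_space tangent_bundle) : affine_quotient :=
  vclass ((trep e).2 + (trep e).1).

Lemma exponential_sprayE v u : exponential_spray (tclass (v, u)) = vclass (u + v).
Proof.
rewrite /exponential_spray; have [g ->] := trep_class (v, u).
by rewrite /tangent_act /= -actD vclass_act.
Qed.

Lemma affine_quotient_elliptic : elliptic affine_quotient.
Proof.
exists n, tangent_bundle, exponential_spray; split.
  move=> e; rewrite -(trepK e).
  apply: (holomorphic_induced tparametrized vparametrized (F := fun q => q.2 + q.1)).
    by apply: filterE => -[v u]; exact: exponential_sprayE.
  by apply: differentiableD; [exact: snd_differentiable|exact: fst_differentiable].
move=> x; split; first by rewrite [LHS]exponential_sprayE add0r vrepK.
move=> l bl; have ll : linear (l : V -> V) by move=> a u v; exact: linearP.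
apply: (submersion_induced vparametrized (F := fun w => (l : V -> V) w + vrep x)).
- by move=> w; exact: exponential_sprayE.
- exact: (affine_rV_diff _ _ ll).1.
- move=> w; have [k lK kK] := bl; exists (k w).
  by rewrite (affine_rV_diff _ _ ll).2 kK.
Unshelve. all: by end_near. Qed.

End AffineQuotient.

(** * Quotients of C^3 by free groups *)

Lemma sqrt_sum_sqr_le (R : rcfType) (x y : R) : Num.sqrt (x ^+ 2 + y ^+ 2) <= `|x| + `|y|.
Proof.
have xy0 : 0 <= `|x| + `|y| by rewrite addr_ge0.
rewrite -[leRHS]ger0_norm // -[leRHS]sqrtr_sqr; apply: ler_wsqrtr.
rewrite sqrrD !real_normK ?num_real // addrAC lerDl.
by rewrite mulrn_wge0 // mulr_ge0.
Qed.

Section ComplexTopology.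
Variable R : realType.
Local Notation C := (R[i] : numFieldType).

Lemma pos_complex (e : C) : 0 < e -> exists2 r : R, 0 < r & e = r%:C.
Proof.
by case: e => a b; rewrite ltcE /= => /andP[/eqP -> a0]; exists a.
Qed.

Lemma real_complex_continuous : continuous (fun s : R => s%:C : C).
Proof.
move=> s A; move=> /nbhs_ballP[e /= /pos_complex[r r0 ->] eA].
change (nbhs s ((fun s : R => s%:C : C) @^-1` A)).
apply/nbhs_ballP; exists r => //= u su; apply: eA.
move: su; rewrite /ball /= -(rmorphB (real_complex R)) normc_def /= expr0n /= addr0 sqrtr_sqr.
by rewrite ltcR.
Qed.

(** The balls of radius [1 / (k + 1)] centred at the vectors with
    Gaussian rational coordinates form a basis. *)
Lemma second_countable_rV n : @second_countable ('rV[C]_n : normedModType C).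
Proof.
pose q2 (q : rat * rat) : C := (ratr q.1) +i* (ratr q.2).
pose center (q : 'rV[rat * rat]_n) : ('rV[C]_n : normedModType C) := \row_i q2 (q 0 i).
pose rad (k : nat) : C := (k.+1%:R^-1 : R)%:C.
have rad0 k : 0 < rad k by rewrite ltcR invr_gt0 ltr0n.
have dense (v : ('rV[C]_n : normedModType C)) (e : R) : 0 < e -> exists q, ball (center q) e%:C v.
  move=> e0; have e2 : 0 < e / 2 by rewrite divr_gt0.
  have app (a : R) : exists q : rat, `|ratr q - a| < e / 2.
    have [|q] := @rat_in_itvoo R (a - e / 2) (a + e / 2); first lra.
    rewrite in_itv /= => /andP[q1 q2']; exists q; rewrite ltr_norml; lra.
  pose f (a : R) : rat := sval (cid (app a)).
  have fP a : `|ratr (f a) - a| < e / 2 := svalP (cid (app a)).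
  exists (\row_i (f (complex.Re (v 0 i)), f (complex.Im (v 0 i)))).
  split=> [|i j]; first by rewrite ltcR.
  rewrite ord1 !mxE /q2 /ball /=.
  have := fP (complex.Re (v 0 j)); have := fP (complex.Im (v 0 j)).
  case: (v 0 j) => a b /= fb fa.
  rewrite normc_def /= ltcR.
  have le : Num.sqrt ((ratr (f a) - a) ^+ 2 + (ratr (f b) - b) ^+ 2) <=
     `|ratr (f a) - a| + `|ratr (f b) - b| :> R.
    exact: sqrt_sum_sqr_le.
  apply: le_lt_trans le _; lra.
exists ((fun qk : 'rV[rat * rat]_n * nat => ball (center qk.1) (rad qk.2)) @` setT).
  by apply: sub_countable (card_image_le _ _) _; exact: countableP.
split; first by move=> _ [qk _ <-]; exact: ball_open.
move=> v A /nbhs_ballP[e /= /pos_complex[r r0 ->] rA].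
have [k kr] : exists k : nat, k.+1%:R^-1 < r / 2.
  exists (Num.bound (r / 2)^-1).
  have r2 : 0 < r / 2 by rewrite divr_gt0.
  rewrite -[ltRHS]invrK ltf_pV2 ?posrE ?invr_gt0 ?ltr0n //.
  have := archi_boundP (ltW (_ : 0 < (r / 2)^-1)); rewrite invr_gt0 => /(_ r2) h.
  by apply: lt_trans h _; rewrite ltr_nat.
have [|q qv] := dense v k.+1%:R^-1; first by rewrite invr_gt0 ltr0n.
exists (ball (center q) (rad k)); first by split; [exists (q, k)|].
move=> w qw; apply: rA.
have -> : r%:C = (r / 2)%:C + (r / 2)%:C :> C by rewrite -rmorphD -splitr.
have kr' : rad k <= (r / 2)%:C by rewrite lecR ltW.
apply: (@ball_triangle _ _ (center q)).
  by apply/ball_sym; exact: (le_ball kr').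
exact: (le_ball kr').
Qed.

End ComplexTopology.

Section Segments.
Variables (R : realType) (V : normedModType R[i]).

Definition line_segment (uvs : V * V * R) : V :=
  uvs.1.1 + (uvs.2)%:C *: (uvs.1.2 - uvs.1.1).

Lemma segment_continuous : continuous line_segment.
Proof.
have c1 : continuous (fun uvs : V * V * R => uvs.1.1).
  by move=> q; apply: (@continuous_comp _ _ _ fst fst); exact: cvg_fst.
have c2 : continuous (fun uvs : V * V * R => uvs.1.2).
  by move=> q; apply: (@continuous_comp _ _ _ fst snd); [exact: cvg_fst|exact: cvg_snd].
have c3 : continuous (fun uvs : V * V * R => (uvs.2)%:C : (R[i] : numFieldType)).
  move=> q; apply: (@continuous_comp _ _ _ snd (fun s : R => s%:C : (R[i] : numFieldType))).
    exact: cvg_snd.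
  exact: real_complex_continuous.
move=> q; apply: cvgD; first exact: c1.
apply: (@cvgZ _ _ _ _ _ (fun uvs : V * V * R => (uvs.2)%:C : (R[i] : numFieldType))).
  exact: c3.
by apply: cvgB; [exact: c2|exact: c1].
Qed.

Lemma segment0 u v : line_segment (u, v, 0) = u.
Proof. by rewrite /line_segment /= scale0r addr0. Qed.

Lemma segment1 u v : line_segment (u, v, 1) = v.
Proof. by rewrite /line_segment /= scale1r subrKC. Qed.

Lemma segment_diag u s : line_segment (u, u, s) = u.
Proof. by rewrite /line_segment /= subrr scaler0 addr0. Qed.

Lemma continuous_image_connected (B : topologicalType) (f : V -> B) : continuous f ->
  (forall b, exists v, f v = b) -> connected [set: B].
Proof.
move=> cf sf.
have -> : [set: B] = \bigcup_(v in [set: V])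
    ((fun s : R => f (line_segment (0, v, s))) @` `[0, 1]%classic).
  apply/seteqP; split => // b _; have [v vb] := sf b; exists v => //.
  by exists 1; rewrite ?segment1 //= in_itv /= ler01 lexx.
apply: bigcup_connected.
  exists (f 0) => v _; exists 0; rewrite ?segment0 //= in_itv /= ler01 lexx //.
move=> v _; apply: connected_continuous_connected; first exact: segment_connected.
apply: continuous_subspaceT => s.
apply: (@continuous_comp _ _ _ (fun s => line_segment (0, v, s)) f); last exact: cf.
apply: (@continuous_comp _ _ _ (fun s : R => (0 : V, v, s)) line_segment);
  last exact: segment_continuous.
exact: (continuous_pair (@cst_continuous _ _ (0, v)) (@continuous_idf R)).
Qed.

End Segments.

Section FreeQuotient.
Variables (R : realType) (X : choiceType) (idx : X -> nat).
Hypothesis idx_inj : injective idx.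
Local Notation V := ('rV[R[i]]_3 : normedModType R[i]).
Let act : free_group X -> V -> V := @free_act R X idx.

Lemma free_act_differentiable g (v : V) : differentiable (act g) v.
Proof.
have -> : act g = fun u => free_lin idx g u + act g 0.
  by apply/funext => u; rewrite -[in LHS](addr0 u); exact: free_actD.
exact: (affine_rV_diff _ _ (@free_lin_linear R X idx g)).1.
Qed.

(** Finitely many elements can be treated one at a time, by
    continuity and the Hausdorff property. *)
Lemma finite_separation (s : seq (free_group X)) (u v : V) :
  (forall g, g \in s -> act g u <> v) -> exists2 AB : set V * set V,
    open_nbhs u AB.1 /\ open_nbhs v AB.2 &
    forall g z, g \in s -> AB.1 z -> ~ AB.2 (act g z).
Proof.
elim: s => [|g s IH] guv; first by exists (setT, setT) => //; split; split => //; exact: openT.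
have [|[A B] /= [[oA Au] [oB Bv]] AB] := IH; first by move=> h hs; apply: guv; rewrite inE hs orbT.
have gv : act g u <> v by apply: guv; rewrite inE eqxx.
have hV : hausdorff_space V by exact: norm_hausdorff.
move: hV; rewrite open_hausdorff => /(_ _ _ (introN eqP gv)).
move=> [[P Q] /= [/set_mem Pg /set_mem Qv] [oP oQ /eqP PQ]].
exists (A `&` (act g @^-1` P), B `&` Q) => /=.
  split; split => //; apply: openI => //.
  by apply: open_comp => // w _; exact/differentiable_continuous/free_act_differentiable.
move=> h z; rewrite inE => /orP[/eqP ->|hs] [Az Pz] [Bz Qz]; last exact: AB hs Az Bz.
by have : (P `&` Q) (act g z) by []; rewrite PQ.
Qed.

Lemma locally_bounded (v : V) : exists B : R, exists2 A, open_nbhs v A &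
  forall z, A z -> bounded_row B (re_row z).
Proof.
have [B vB] := row_bounded (re_row v); exists (B + 1), (ball v 1).
  exact: ball_open_nbhs.
move=> z [_ vz] i; have := vz 0 i; rewrite /ball /= => vzi.
have := le_lt_trans (normc_ge_Re _) vzi; rewrite ltcR Re_D Re_N.
have := vB i; rewrite !mxE => b1 b2.
have := ler_normB (complex.Re (v 0 i)) (complex.Re (v 0 i) - complex.Re (z 0 i)).
rewrite subKr; lra.
Qed.

(** On bounded neighbourhoods only finitely many elements matter,
    by [free_act_finite]. *)
Lemma free_act_separating : separating act.
Proof.
move=> u v; have [Bu [A [oA Au] bA]] := locally_bounded u.
have [Bv [B [oB Bv'] bB]] := locally_bounded v.
pose b := Num.max Bu Bv.
have [s sE] := (finite_seqP _).1 (free_act_finite idx_inj b).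
have [|[A' B'] /= [[oA' A'u] [oB' B'v]] AB] := @finite_separation [seq g <- s | act g u != v] u v.
  by move=> g; rewrite mem_filter => /andP[/eqP].
exists (A `&` A', B `&` B') => /=.
  by split; split => //; exact: openI.
move=> g z [Az A'z] [Bz B'z]; apply: contrapT => /eqP guv.
apply: (AB g z) => //; rewrite mem_filter guv /=.
have : [set g | exists v, bounded_row b (re_row v) /\ bounded_row b (re_row (free_act idx g v))] g.
  exists z; split=> i.
    by apply: le_trans (bA _ Az i) _; rewrite /b le_max lexx.
  by apply: le_trans (bB _ Bz i) _; rewrite /b le_max lexx orbT.
by rewrite sE.
Qed.

Lemma free_act_proper : proper_action act.
Proof.
split.
- exact: free_act1.
- exact: free_actM.
- move=> g v; exact: (free_act_free idx_inj).
- exact: free_act_differentiable.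
- exact: free_act_separating.
Qed.

Lemma free_quotient : exists S : complex_manifold V,
  [/\ [set: S] !=set0 /\ connected [set: S], elliptic S,
    forall x : S, isomorphic_groups (homotopy_group R x 1) (free_group X)
  & forall (n : nat) (x : S), (n > 1)%N -> forall a : homotopy_group R x n,
      a = homotopy_class (constant_spheroid R x n)].
Proof.
pose p := orbit_class free_act_proper.
have hV : hausdorff_space V by exact: norm_hausdorff.
have cp : continuous p := @orbit_continuous _ _ _ _ free_act_proper.
have sp := @orbit_surj _ _ _ _ free_act_proper.
exists (affine_quotient free_act_proper (@second_countable_rV R 3)); split.
- split; first by exists (p 0).
  exact: (continuous_image_connected cp sp).
- apply: (@affine_quotient_elliptic R 3 _ act (@free_lin R X idx)).
    exact: free_lin_linear.
  exact: free_actD.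
- move=> x; have [e0 e0x] := sp x.
  apply: (@pi1_isomorphic R V _ p hV cp (@orbit_local_inj _ _ _ _ free_act_proper)
    (@orbit_section _ _ _ _ free_act_proper) _ act _ _ _ _ _ _ (@line_segment R V)
    (@segment_continuous R V) (@segment0 R V) (@segment1 R V) (@segment_diag R V) x e0 e0x).
  + exact: (proper_act1 free_act_proper).
  + exact: (proper_actM free_act_proper).
  + exact: (proper_act_continuous free_act_proper).
  + exact: (proper_act_free free_act_proper).
  + exact: orbit_act.
  + by move=> e e' /orbitP.
- move=> n x; apply: (@higher_homotopy_trivial R V _ p hV cp
    (@orbit_local_inj _ _ _ _ free_act_proper) (@orbit_section _ _ _ _ free_act_proper) sp
    (@line_segment R V)
    (@segment_continuous R V) (@segment0 R V) (@segment1 R V) (@segment_diag R V)).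
Qed.

End FreeQuotient.

Local Close Scope ring_scope.
Local Close Scope quotient_scope.

Theorem theorem2 (R : realType) (k : option nat) :
  exists S : complex_manifold 'rV[R[i]]_3,
    [/\ [set: S] !=set0 /\ connected [set: S],
        elliptic S,
        forall x : S,
          isomorphic_groups (homotopy_group R x 1) (free_group_of_rank k)
      & forall (n : nat) (x : S), (n > 1)%N ->
          forall a : homotopy_group R x n,
            a = homotopy_class (constant_spheroid R x n)].
Proof.
case: k => [k|]; first exact: (@free_quotient R 'I_k (@nat_of_ord k) val_inj).
exact: (@free_quotient R nat (fun i => i) (@inj_id nat)).
Qed.
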